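(* The image of the group $\mathcal{P}^n$ under the mapping $\varphi:\mathcal{P}\to\mathcal{D}^*[\alpha]$ consists of all homogeneous functions $\psi(\alpha)\in\mathcal{D}^*[\alpha]$ of degree $n$ such that $$\psi(-\alpha)\,\Phi(\alpha)D=\psi(\alpha)\,D\qquad\text{for all }D\in\mathcal{D},$$ that is, the value of $\psi(-\alpha)$ on $\Phi(\alpha)D$ equals the value of $\psi(\alpha)$ on $D$.
   Context: A combinatorial polytope is a combinatorial equivalence class of convex polytopes. The ring of polytopes $\mathcal{P}$ is, as an abelian group, free on all (non-empty) combinatorial polytopes, with multiplication the direct product and unit the point; $\mathcal{P}^n$ is the subgroup generated by $n$-dimensional polytopes. The operator $d_k$ sends an $n$-dimensional polytope to the sum of all its $(n-k)$-dimensional (non-empty) faces ($d_0=\mathrm{id}$). $\mathcal{D}\subset\mathrm{Hom}_{\mathbb Z}(\mathcal{P},\mathcal{P})$ is the subring (under composition) generated by $d_k$, $k\ge1$, graded by $\deg d_k=k$; it is a graded Hopf algebra with $\Delta d_k=\sum_{i+j=k}d_i\otimes d_j$, and $\mathcal{D}^*$ is its graded dual over $\mathbb{Z}$. $\Phi(t)=\sum_{k\ge0}d_kt^k\in\mathcal{D}[[t]]$. The linear map $\xi_\alpha:\mathcal{P}\to\mathbb{Z}[\alpha]$ is $\xi_\alpha(P^n)=\alpha^n$. The map $\varphi:\mathcal{P}\to\mathcal{D}^*[\alpha]$, $p\mapsto\varphi_{\alpha,p}$, is defined by $\varphi_{\alpha,p}(D)=\xi_\alpha(Dp)$ for $D\in\mathcal{D}$;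 it is a ring homomorphism. The ring $\mathcal{D}^*[\alpha]$ is graded with $\deg(\alpha^i\psi_i)=i+\deg\psi_i$ for homogeneous $\psi_i\in\mathcal{D}^*$. An element $\psi(\alpha)=\sum_i\psi_i\alpha^i$ is evaluated on $\sum_kD_k\alpha^k\in\mathcal{D}[[\alpha]]$ by $\sum_{i,k}\psi_i(D_k)\alpha^{i+k}$. *)

(* Defs.v *)
From HB Require Import structures.
From mathcomp Require Import all_boot all_order all_algebra.
From mathcomp Require Import generic_quotient.
From mathcomp Require Import mathcomp_extra boolp classical_sets functions.
From mathcomp Require Import cardinality fsbigop reals.
From mathcomp Require Import freeg.

Set Implicit Arguments.
Unset Strict Implicit.
Unset Printing Implicit Defensive.

Import Order.TTheory GRing.Theory Num.Theory.

Local Open Scope classical_set_scope.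
Local Open Scope ring_scope.
Local Open Scope quotient_scope.

Section ConvexPolytopes.
Variable R : realType.

Definition dotp d (x : 'rV[R]_d) (u : 'cV[R]_d) : R := (x *m u) 0 0.

(* Convex hull of the rows of V. *)
Definition conv m d (V : 'M[R]_(m, d)) : set 'rV[R]_d :=
  [set x | exists a : 'rV[R]_m,
     [/\ forall i, 0 <= a 0 i, \sum_i a 0 i = 1 & x = a *m V]].

Definition is_polytope d (A : set 'rV[R]_d) : Prop :=
  A !=set0 /\ exists m (V : 'M[R]_(m, d)), A = conv V.

(* Nonempty faces; u = 0 and c = 0 gives A itself. *)
Definition faces d (A : set 'rV[R]_d) : set (set 'rV[R]_d) :=
  [set F | F !=set0 /\ exists (u : 'cV[R]_d) (c : R),
     (forall x, A x -> dotp x u <= c) /\ F = [set x | A x /\ dotp x u = c]].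

(* Dimension of the affine hull: the largest r such that A contains r + 1
   affinely independent points x0, x0 + row 0 M, ..., x0 + row (r-1) M. *)
Definition has_indep d (A : set 'rV[R]_d) (r : nat) : Prop :=
  exists (x0 : 'rV[R]_d) (M : 'M[R]_(r, d)),
    [/\ A x0, forall i, A (x0 + row i M) & row_free M].

Definition dim d (A : set 'rV[R]_d) : nat :=
  \max_(r < d.+1 | `[< has_indep A r >]) r.

Lemma dotpD d (x y : 'rV[R]_d) u : dotp (x + y) u = dotp x u + dotp y u.
Proof. by rewrite /dotp mulmxDl mxE. Qed.

Lemma dotp_row m d (V : 'M[R]_(m, d)) u i : dotp (row i V) u = (V *m u) i 0.
Proof. by rewrite /dotp -row_mul mxE. Qed.

Lemma dotp_conv m d (V : 'M[R]_(m, d)) (u : 'cV[R]_d) (a : 'rV[R]_m) :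
  dotp (a *m V) u = \sum_i a 0 i * dotp (row i V) u.
Proof.
by rewrite /dotp -mulmxA mxE; apply: eq_bigr => i _; rewrite -dotp_row.
Qed.

Lemma row_conv m d (V : 'M[R]_(m, d)) i : conv V (row i V).
Proof.
exists (delta_mx 0 i); split; last by rewrite rowE.
- by move=> j; rewrite mxE ler0n.
- rewrite (bigD1 i) //= big1 ?addr0 => [|j ji]; first by rewrite mxE !eqxx.
  by rewrite mxE (negPf ji) andbF.
Qed.

Lemma conv_face m d (V : 'M[R]_(m, d)) (u : 'cV[R]_d) (c : R) :
  (forall x, conv V x -> dotp x u <= c) ->
  [set x | conv V x /\ dotp x u = c] =
  conv (rowsub (enum_val : 'I_#|[set i | dotp (row i V) u == c]%SET| -> _) V).
Proof.
move=> Vc; set T := [set i | _]%SET; apply/seteqP; split=> x /=.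
- case=> -[a [a0 a1 ->]]; rewrite dotp_conv => ac.
  have aT i : i \notin T -> a 0 i = 0.
    rewrite inE => ic; have dc : 0 < c - dotp (row i V) u.
      by rewrite subr_gt0 lt_neqAle ic Vc //; apply: row_conv.
    have s0 : \sum_j a 0 j * (c - dotp (row j V) u) = 0.
      under eq_bigr do rewrite mulrBr.
      by rewrite sumrB -mulr_suml a1 ac mul1r subrr.
    have nn j : true -> 0 <= a 0 j * (c - dotp (row j V) u).
      by move=> _; rewrite mulr_ge0 // subr_ge0 Vc //; apply: row_conv.
    move/eqP: s0; rewrite psumr_eq0 // => /allP /(_ i (mem_index_enum _)) /=.
    by rewrite mulf_eq0 (gt_eqF dc) orbF => /eqP.
  have sumT (Z : zmodType) (f : 'I_m -> Z) : (forall i, i \notin T -> f i = 0) ->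
      \sum_(j < #|T|) f (enum_val j) = \sum_i f i.
    move=> f0; rewrite -big_enum_val [RHS](bigID (mem T)) /=.
    by rewrite [X in _ = _ + X]big1 ?addr0.
  exists (\row_j a 0 (enum_val j)); split.
  + by move=> j; rewrite mxE.
  + under eq_bigr do rewrite mxE.
    by rewrite (sumT _ (fun i => a 0 i)).
  + apply/rowP => k; rewrite !mxE.
    under [RHS]eq_bigr do rewrite !mxE.
    by rewrite (sumT _ (fun i => a 0 i * V i k)) // => i /aT ->; rewrite mul0r.
- case=> b [b0 b1 ->].
  set a : 'rV_m := b *m rowsub enum_val 1%:M.
  have Ea : b *m rowsub enum_val V = a *m V.
    by rewrite -mulmxA mul_rowsub_mx mul1mx.
  rewrite Ea; split.
  + exists a; split=> //.
    * move=> i; rewrite mxE sumr_ge0 // => j _; rewrite mulr_ge0 // !mxE.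
      exact: ler0n.
    * under eq_bigr do rewrite mxE.
      rewrite exchange_big /= -[RHS]b1; apply: eq_bigr => j _.
      rewrite -mulr_sumr (bigD1 (enum_val j)) //= big1 ?addr0.
        by rewrite !mxE eqxx mulr1.
      by move=> i ij; rewrite !mxE eq_sym (negPf ij).
  + rewrite -Ea dotp_conv -[RHS]mul1r -b1 mulr_suml; apply: eq_bigr => j _.
    congr (_ * _); have := enum_valP j; rewrite inE => /eqP <-.
    by congr dotp; apply/rowP => k; rewrite !mxE.
Qed.

Lemma face_polytope d (A F : set 'rV[R]_d) :
  is_polytope A -> faces A F -> is_polytope F.
Proof.
move=> [_ [m [V ->]]] [F0 [u [c [Vc FE]]]]; split=> //.
by rewrite FE conv_face //; do 2 eexists.
Qed.

Lemma dim_ge d (A : set 'rV[R]_d) r : has_indep A r -> (r <= dim A)%N.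
Proof.
move=> Ar; have rd : (r < d.+1)%N.
  by case: Ar => x0 [M [_ _ /eqP <-]]; rewrite ltnS rank_leq_col.
by apply: (leq_bigmax_cond (Ordinal rd)); apply/asboolP.
Qed.

Lemma dim_indep d (A : set 'rV[R]_d) : A !=set0 -> has_indep A (dim A).
Proof.
case=> x0 Ax0; have A0 : has_indep A 0.
  exists x0, 0; split=> //; first by case.
  by rewrite /row_free mxrank0.
rewrite /dim; have [|r /asboolP Ar ->] // :=
  @eq_bigmax_cond _ [pred r : 'I_d.+1 | `[< has_indep A r >]] (@nat_of_ord _).
by apply/card_gt0P; exists ord0; apply/asboolP.
Qed.

Lemma face_dim_eq d (A F : set 'rV[R]_d) : faces A F -> dim F = dim A -> F = A.
Proof.
move=> [F0 [u [c [Ac FE]]]] dFA; apply: contrapT => FA.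
have [y [Ay yc]] : exists y, A y /\ dotp y u <> c.
  apply: contrapT => /forallNP nA; apply: FA; rewrite FE; apply/seteqP.
  split=> x /= => [[]//|Ax]; split=> //; apply: contrapT => xc.
  by apply: (nA x).
have [x0 [M [Fx0 FM freeM]]] := dim_indep F0.
have FAs x : F x -> A x /\ dotp x u = c by rewrite FE.
suff : has_indep A (dim F + 1) by move/dim_ge; rewrite dFA addn1 ltnn.
exists x0, (col_mx M (y - x0)); split; first by have [] := FAs _ Fx0.
  move=> i; case: (split_ordP i) => j ->.
    by rewrite rowKu; have [] := FAs _ (FM j).
  by rewrite rowKd [j]ord1 row_id addrC subrK.
have Mu : M *m u = 0.
  apply/colP => i; rewrite [RHS]mxE -dotp_row.
  have [_] := FAs _ (FM i); have [_ <-] := FAs _ Fx0.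
  by rewrite dotpD -[RHS]addr0 => /addrI.
have yx0 : dotp (y - x0) u != 0.
  have [_ xc] := FAs _ Fx0; apply/eqP => yx; apply: yc.
  by rewrite -(subrK x0 y) dotpD yx add0r.
apply: inj_row_free => v; rewrite -[v]hsubmxK mul_row_col => v0.
have v2 : rsubmx v = 0.
  have := congr1 (mulmx^~ u) v0.
  rewrite /= mulmxDl -!mulmxA Mu mulmx0 add0r mul0mx => /matrixP /(_ 0 0).
  rewrite [rsubmx v]mx11_scalar mul_scalar_mx !mxE.
  move=> /eqP; rewrite mulf_eq0 => /orP[/eqP ->|]; first by rewrite raddf0.
  by move: yx0; rewrite /dotp mxE => /negPf ->.
move: v0; rewrite v2 mul0mx addr0 => v0.
have -> : lsubmx v = 0 by apply: (row_free_inj freeM); rewrite v0 mul0mx.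
by rewrite row_mx0.
Qed.

Lemma finite_faces d (A : set 'rV[R]_d) : is_polytope A -> finite_set (faces A).
Proof.
move=> [_ [m [V ->]]].
apply: (@sub_finite_set _ _ ((fun T : {set 'I_m} =>
  conv (rowsub (enum_val : 'I_#|T| -> _) V)) @` setT)).
  by move=> F [_ [u [c [Vc ->]]]]; rewrite conv_face //; eexists.
exact/finite_image/finite_finset.
Qed.

Record polytope := Polytope {
  ambient : nat;
  points :> set 'rV[R]_ambient;
  polytopeP : is_polytope points }.

HB.instance Definition _ := gen_eqMixin polytope.
HB.instance Definition _ := gen_choiceMixin polytope.

Definition face_of (Q : polytope) (F : faces Q) : polytope :=
  Polytope (face_polytope (polytopeP Q) (set_mem (valP F))).

(* Isomorphism of the posets of nonempty faces. *)
Definition comb_equiv (Q Q' : polytope) : Prop :=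
  exists f : faces Q -> faces Q', bijective f /\
    forall F G, (val F `<=` val G) <-> (val (f F) `<=` val (f G)).

Definition comb_equivb (Q Q' : polytope) : bool := `[< comb_equiv Q Q' >].

Lemma comb_equivb_refl : reflexive comb_equivb.
Proof. by move=> Q; apply/asboolP; exists id; split=> //; exists id. Qed.

Lemma comb_equivb_sym : symmetric comb_equivb.
Proof.
suff H Q Q' : comb_equiv Q Q' -> comb_equiv Q' Q.
  by move=> Q Q'; apply/asboolP/asboolP; apply: H.
case=> f [[g fK gK] fS]; exists g; split; first by exists f.
by move=> F G; rewrite fS !gK.
Qed.

Lemma comb_equivb_trans : transitive comb_equivb.
Proof.
move=> Q2 Q1 Q3 /asboolP[f [bf fS]] /asboolP[g [bg gS]]; apply/asboolP.
by exists (g \o f); split=> [|F G]; [exact: bij_comp | rewrite fS gS].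
Qed.

Canonical comb_equiv_rel :=
  EquivRel comb_equivb comb_equivb_refl comb_equivb_sym comb_equivb_trans.

Definition comb_polytope := {eq_quot comb_equiv_rel}.
HB.instance Definition _ := Choice.on comb_polytope.
HB.instance Definition _ := EqQuotient.on comb_polytope.

Definition comb_class (Q : polytope) : comb_polytope := \pi_comb_polytope Q.

End ConvexPolytopes.

Section Subgroup.
Variable U : zmodType.

Definition subgroup_gen (G : set U) : set U :=
  smallest (fun S : set U => zmod_closed (mem S)) G.

End Subgroup.

(* Hom_Z(U, U), a ring under composition. *)
Section Endomorphisms.
Variable U : zmodType.

Definition endo := {additive U -> U}.

Implicit Types f g h : endo.

Lemma endoP f g : f =1 g -> f = g.
Proof.
case: f g => [f [[Hf]]] [g [[Hg]]] /= /funext fg; subst g.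
by rewrite (Prop_irrelevance Hf Hg).
Qed.

HB.instance Definition _ := gen_eqMixin endo.
HB.instance Definition _ := gen_choiceMixin endo.

Definition endo_zero : endo := \0.
Definition endo_opp f : endo := \- f.
Definition endo_add f g : endo := f \+ g.
Definition endo_one : endo := idfun.
Definition endo_mul f g : endo := f \o g.

Let addA : associative endo_add.
Proof. by move=> f g h; apply: endoP => x; rewrite /= addrA. Qed.
Let addC : commutative endo_add.
Proof. by move=> f g; apply: endoP => x; rewrite /= addrC. Qed.
Let add0 : left_id endo_zero endo_add.
Proof. by move=> f; apply: endoP => x; rewrite /= add0r. Qed.
Let addN : left_inverse endo_zero endo_opp endo_add.
Proof. by move=> f; apply: endoP => x; rewrite /= addNr. Qed.

HB.instance Definition _ := GRing.isZmodule.Build endo addA addC add0 addN.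

Let mulA : associative endo_mul.
Proof. by move=> f g h; apply: endoP. Qed.
Let mul1 : left_id endo_one endo_mul.
Proof. by move=> f; apply: endoP. Qed.
Let mulr1 : right_id endo_one endo_mul.
Proof. by move=> f; apply: endoP. Qed.
Let mulDl : left_distributive endo_mul +%R.
Proof. by move=> f g h; apply: endoP. Qed.
Let mulDr : right_distributive endo_mul +%R.
Proof. by move=> f g h; apply: endoP => x; apply: raddfD. Qed.

HB.instance Definition _ :=
  GRing.Zmodule_isPzRing.Build endo mulA mul1 mulr1 mulDl mulDr.

Definition subring_gen (G : set endo) : set endo :=
  smallest (fun S : set endo => subring_closed (mem S)) G.

Lemma subring_gen_closed G : subring_closed (mem (subring_gen G)).
Proof.
split; first by apply/mem_set => S [[S1 _ _] _]; exact: set_mem.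
- move=> x y /set_mem Gx /set_mem Gy; apply/mem_set => S GS.
  have [_ SB _] := GS.1.
  by apply/set_mem/SB; apply/mem_set; [apply: Gx | apply: Gy].
- move=> x y /set_mem Gx /set_mem Gy; apply/mem_set => S GS.
  have [_ _ SM] := GS.1.
  by apply/set_mem/SM; apply/mem_set; [apply: Gx | apply: Gy].
Qed.

End Endomorphisms.

Section FaceOperators.
Variable R : realType.

Definition polytope_group := {freeg (comb_polytope R) / int}.
HB.instance Definition _ := GRing.Lmodule.on polytope_group.

Definition generator (Q : polytope R) : polytope_group := << comb_class Q >>.

Definition graded_part (n : nat) : set polytope_group :=
  subgroup_gen [set generator Q | Q in [set Q : polytope R | dim Q = n]].

(* Dimensions, and the classes of the faces, are invariants of combinatorial
   equivalence, so they may be read off any representative. *)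
Definition class_dim (x : comb_polytope R) : nat := dim (repr x).

(* The faces of codimension k; finitely many by finite_faces, so that the
   finite-support sum is the actual sum. *)
Definition class_face_sum (k : nat) (x : comb_polytope R) : polytope_group :=
  \sum_(F \in [set F : faces (repr x) | (dim (val F) + k)%N = class_dim x])
    generator (face_of F).

Definition face_op_fun (k : nat) : polytope_group -> polytope_group :=
  fglift (class_face_sum k).

Lemma face_op_additive k : zmod_morphism (face_op_fun k).
Proof. exact: lift_is_additive. Qed.

HB.instance Definition _ k :=
  GRing.isZmodMorphism.Build polytope_group polytope_group (face_op_fun k)
    (face_op_additive k).

Definition face_op (k : nat) : endo polytope_group := face_op_fun k.

Definition Dset : set (endo polytope_group) :=
  subring_gen [set face_op k | k in [set k | (0 < k)%N]].

Definition in_D : pred (endo polytope_group) := fun x => x \in Dset.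

Lemma in_D_closed : subring_closed in_D.
Proof. exact: subring_gen_closed. Qed.

Definition Dring := {x : endo polytope_group | in_D x}.
HB.instance Definition _ := SubChoice.on Dring.
HB.instance Definition _ :=
  GRing.SubChoice_isSubPzRing.Build (endo polytope_group) in_D Dring in_D_closed.

Lemma polytope_self (Q : polytope R) : faces Q Q.
Proof.
split; first by have [] := polytopeP Q.
exists 0, 0; split=> [x _|]; first by rewrite /dotp mulmx0 mxE.
by apply/seteqP; split=> x /= => [Qx|[]//]; rewrite /dotp mulmx0 mxE.
Qed.

Lemma polytope_eta (Q : polytope R) (QP : is_polytope Q) : Polytope QP = Q.
Proof. by case: Q QP => d A AP QP; congr Polytope; apply: Prop_irrelevance. Qed.

Lemma class_face_sum0 x : class_face_sum 0 x = << x >>.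
Proof.
pose F0 : faces (repr x) := SigSub (mem_set (polytope_self (repr x))).
rewrite /class_face_sum (_ : [set F | _] = [set F0]); last first.
  apply/seteqP; split=> F /=; last by move=> ->; rewrite addn0.
  rewrite addn0 => dF; apply: val_inj => /=.
  exact: (face_dim_eq (set_mem (valP F))).
rewrite fsbig_set1 /generator; congr << _ >>.
rewrite -[RHS]reprK /comb_class; congr (\pi _).
exact: polytope_eta.
Qed.

Lemma face_op0 : face_op 0 = 1.
Proof.
apply: endoP => p; rewrite -[RHS]/p -{1}(freeg_sumE p) raddf_sum.
rewrite -[RHS]freeg_sumE; apply: eq_bigr => x _ /=.
rewrite /face_op_fun liftU class_face_sum0.
by apply/eqP/freeg_eqP => y; rewrite coeffZ !coeffU mul1r.
Qed.

Lemma face_op_in k : in_D (face_op k).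
Proof.
case: k => [|k]; first by rewrite face_op0; have [] := in_D_closed.
apply: mem_set; apply: (@sub_gen_smallest _ _ [set face_op k | k in _]).
by exists k.+1.
Qed.

Definition dD (k : nat) : Dring := Sub (face_op k) (face_op_in k).

(* D^k: the d_k generate D, so D^k is spanned by the monomials in them of
   total degree k. *)
Definition Dgraded (k : nat) : set Dring :=
  subgroup_gen [set \prod_(i <- s) dD i |
    s in [set s : seq nat | all (leq 1) s /\ sumn s = k]].

(* Hom_Z(D^j, Z), as the homomorphisms on D vanishing on the other D^k. *)
Definition dual_deg (j : nat) : set (Dring -> int) :=
  [set f | zmod_morphism f /\ forall k D, k <> j -> Dgraded k D -> f D = 0].

Definition graded_dual : set (Dring -> int) :=
  [set f | zmod_morphism f /\
    exists N : nat, forall k D, (N <= k)%N -> Dgraded k D -> f D = 0].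

(* An element sum_i psi_i alpha^i of D^*[alpha] is represented by the function
   D |-> sum_i psi_i(D) alpha^i from D to Z[alpha], which determines it. *)
Definition dual_poly : set (Dring -> {poly int}) :=
  [set psi | exists (N : nat) (psi_ : nat -> Dring -> int),
    (forall i, graded_dual (psi_ i)) /\
    forall D, psi D = \poly_(i < N) psi_ i D].

Definition dual_coef (psi : Dring -> {poly int}) (i : nat) : Dring -> int :=
  fun D => (psi D)`_i.

Definition homogeneous (n : nat) (psi : Dring -> {poly int}) : Prop :=
  (forall i j, (i + j)%N = n -> dual_deg j (dual_coef psi i)) /\
  (forall i, (n < i)%N -> dual_coef psi i = 0).

(* psi(-alpha) *)
Definition dual_neg (psi : Dring -> {poly int}) : Dring -> {poly int} :=
  fun D => psi D \Po (- 'X).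

(* Power series, with coefficients in D or in Z, are coefficient sequences. *)
Definition dual_eval (psi : Dring -> {poly int}) (S : nat -> Dring) :
    nat -> int :=
  fun m => \sum_(i < m.+1) dual_coef psi i (S (m - i)%N).

Definition const_series (D : Dring) : nat -> Dring :=
  fun k => if k is 0%N then D else 0.

Definition Phi : nat -> Dring := dD.

Definition series_mul (S T : nat -> Dring) : nat -> Dring :=
  fun m => \sum_(i < m.+1) S i * T (m - i)%N.

Definition xi : polytope_group -> {poly int} :=
  fglift (fun x : comb_polytope R => 'X^(class_dim x) : {poly int}).

Definition phi (p : polytope_group) : Dring -> {poly int} :=
  fun D => xi ((val D : endo polytope_group) p).

End FaceOperators.

(* Main.v *)
(** Idea. For [p] of dimension [n] the equation is Euler's relation for the
    faces of the polytopes in [D p]. Conversely, Euler's relation for the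
    intervals [G, Q] of face lattices reads sum_i (-1)^i d_i d_(m-i) = 0. It
    expresses d_k d_1 by products whose last factor is not d_1, so that D is
    spanned by the monomials w in the d_k with k >= 2 and by the d_1 w, and the
    functional equation determines psi (d_1 w) from the values of psi on the w.
    All integral values on the monomials w of degree at most n are attained on
    P^n: if C is the pyramid and B the bipyramid, then c = 2C - B satisfies
    d_k c = d_(k-1) for k >= 2, while d = BC - CB satisfies d_2 d = 1 and
    d_k d = 0 for k >= 3, so that one can argue by induction on n, splitting
    off the factor of w that acts first.

    Euler's relation is proved for the cells of polyhedral cones, by induction
    on the number of inequalities. Cutting a cone by a hyperplane shows that
    reversing an inequality does not affect the claim; if some inequality
    depends linearly on the others, suitable reversals turn it into an
    equality. *)
Require Import Defs.
From HB Require Import structures.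
From mathcomp Require Import all_boot all_order all_algebra.
From mathcomp Require Import boolp ring lra zify.
Set Implicit Arguments.
Unset Strict Implicit.
Unset Printing Implicit Defensive.
Import Order.TTheory GRing.Theory Num.Theory.
Local Open Scope ring_scope.

(** * Euler's relation for polyhedral cones *)

(** Over the rationals linearly independent values would suffice; over the integers every integral
    vector of values has to be attained. Hence the operators c and d, whose effect on the face
    operators has coefficients 0 and 1: through them the values on the monomials with indices at
    least 2 become free coordinates on the image. Likewise d_k d_1 occurs in Euler's relation with
    coefficient 1 or -1, so it can be eliminated over Z.

    Cones enter as normal cones: the faces above G are the cells of the cone of functionals that
    attain their maximum over Q on G, so no quotient polytope has to be constructed. Redundant and
    degenerate systems of inequalities are allowed, since reversing inequalities produces them. A
    cone that is a linear subspace is the exception to the relation, as it has a single cell; the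
    case distinctions of the induction keep track of these.

    Only nonempty faces belong to the ring, so the interval from the empty face to Q has to be
    obtained as the interval above the apex of a pyramid. The missing empty face also causes the
    point terms in the formulas for C and B; they cancel in c and d. *)

Section ConeEuler.
Variables (R : realFieldType) (m d : nat) (V : 'M[R]_(m, d)).
Implicit Types (u w : 'cV[R]_d) (s : 'I_m -> bool) (Z E A T : {set 'I_m}).

Definition row_span T : 'M[R]_d := (\sum_(j in T) <<row j V>>)%MS.

Definition row_val u i : R := (V *m u) i 0.

Definition signed_val s u i : R := (-1) ^+ s i * row_val u i.

Lemma row_valD u w i : row_val (u + w) i = row_val u i + row_val w i.
Proof. by rewrite /row_val mulmxDr mxE. Qed.

Lemma row_valZ (t : R) u i : row_val (t *: u) i = t * row_val u i.
Proof. by rewrite /row_val -scalemxAr mxE. Qed.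

Lemma signed_valD s u w i : signed_val s (u + w) i =
  signed_val s u i + signed_val s w i.
Proof. by rewrite /signed_val row_valD mulrDr. Qed.

Lemma signed_valZ s (t : R) u i : signed_val s (t *: u) i =
  t * signed_val s u i.
Proof. by rewrite /signed_val row_valZ mulrCA. Qed.

Lemma signed_val_eq0 s u i : (signed_val s u i == 0) = (row_val u i == 0).
Proof. by rewrite /signed_val mulf_eq0 signr_eq0. Qed.

Lemma row_span_kills T u :
  row_span T *m u = 0 <-> (forall j, j \in T -> row_val u j = 0).
Proof.
split=> [/eqP|H].
  rewrite -sub_kermx => /sumsmx_subP H j jT; move: (H j jT).
  rewrite genmxE sub_kermx => /eqP /matrixP /(_ 0 0).
  by rewrite -row_mul mxE [RHS]mxE.
apply/eqP; rewrite -sub_kermx; apply/sumsmx_subP => j jT.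
rewrite genmxE sub_kermx -row_mul; apply/eqP/matrixP => a b.
by rewrite !ord1 mxE [RHS]mxE; apply: H.
Qed.

Lemma row_span_setU1 i T : (row_span (i |: T) :=: row i V + row_span T)%MS.
Proof.
apply/eqmxP/andP; split.
  apply/sumsmx_subP => j; rewrite in_setU1 => /predU1P[->|jT].
    by rewrite genmxE addsmxSl.
  by apply: submx_trans (addsmxSr _ _); apply: (sumsmx_sup j).
rewrite addsmx_sub; apply/andP; split.
  by apply: (sumsmx_sup i); rewrite ?setU11 // genmxE.
apply/sumsmx_subP => j jT; apply: (sumsmx_sup j) => //.
by rewrite in_setU1 jT orbT.
Qed.

Lemma row_sub_kills i T u : (row i V <= row_span T)%MS ->
  (forall j, j \in T -> row_val u j = 0) -> row_val u i = 0.
Proof.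
move=> /submxP[B rB] /row_span_kills H.
have := congr1 (fun M => (M *m u) 0 0) rB.
by rewrite /= -mulmxA H mulmx0 -row_mul mxE [RHS]mxE.
Qed.

Lemma row_sub_rank i T : (row i V <= row_span T)%MS ->
  \rank (row_span (i |: T)) = \rank (row_span T).
Proof.
by move=> H; rewrite (row_span_setU1 i T); apply/eqmx_rank/eqmxP/addsmx_idPr.
Qed.

(** A column of the cokernel matrix of [row_span T] on which row i does not vanish gives the vector,
    after rescaling. It serves below as a direction transverse to the hyperplane of row i. *)
Lemma row_nsub_separated i T : ~~ (row i V <= row_span T)%MS ->
  \rank (row_span (i |: T)) = (\rank (row_span T)).+1 /\
  exists u, (forall j, j \in T -> row_val u j = 0) /\ row_val u i = 1.
Proof.
move=> H; split.
  rewrite (row_span_setU1 i T); apply/eqP; rewrite eqn_leq; apply/andP; split.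
    apply: (leq_trans (mxrank_adds_leqif _ _)).
    exact: (leq_add (rank_leq_row _) (leqnn _)).
  rewrite ltn_neqAle (mxrankS (addsmxSr _ _)) andbT.
  apply: contra H => /eqP e.
  have := mxrank_leqif_sup (addsmxSr (row i V) (row_span T)).
  rewrite /leqif e eqxx => -[_ /esym e'].
  by apply: submx_trans e'; rewrite addsmxSl.
move: H; rewrite submxE => /eqP H.
have [k Hk] : exists k, (row i V *m cokermx (row_span T)) 0 k != 0.
  apply: contrapT => /forallNP Hn; apply: H; apply/matrixP => a b.
  by rewrite ord1 [RHS]mxE; apply/eqP/negPn/negP/Hn.
set w := col k (cokermx (row_span T)).
have wi : row_val w i != 0.
  suff -> : row_val w i = (row i V *m cokermx (row_span T)) 0 k by [].
  by rewrite /row_val /w colE mulmxA -colE mxE -row_mul [RHS]mxE.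
exists ((row_val w i)^-1 *: w); split.
  move=> j jT; rewrite row_valZ; have -> : row_val w j = 0.
    move: j jT; apply/row_span_kills.
    by rewrite /w colE mulmxA mulmx_coker mul0mx.
  by rewrite mulr0.
by rewrite row_valZ mulVf.
Qed.

Definition cell s Z A u : Prop :=
  (forall i, i \in Z -> row_val u i = 0) /\ (forall i, i \in A ->
    0 < signed_val s u i).

Definition realized s Z A : bool := `[< exists u, cell s Z A u >].

(* The sum over the cells of the cone with equations E and inequalities A; T is
   the set of strict inequalities of a cell, and the rank is its codimension. *)
Definition cone_euler s E A : int :=
  \sum_(T : {set 'I_m} | T \subset A)
    (realized s (E :|: (A :\: T)) T)%:R * (-1) ^+ \rank (row_span (E :|: (A
      :\: T))).

Lemma big_subset_setU1 (U : zmodType) i A (f : {set 'I_m} -> U) : i \notin A ->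
  \sum_(T : {set 'I_m} | T \subset i |: A) f T =
  \sum_(T : {set 'I_m} | T \subset A) (f T + f (i |: T)).
Proof.
move=> iA; rewrite big_split /= (bigID (fun T : {set 'I_m} =>
  i \in T)) /= addrC.
congr (_ + _).
  apply: eq_bigl => T; apply/andP/idP => [[TA iT]|TA].
    by rewrite -(setU1K iA) subsetD1 TA.
  split; first by exact: (subset_trans TA (subsetUr _ _)).
  exact: (contra (subsetP TA i) iA).
rewrite (reindex_onto (fun T => i |: T) (fun T => T :\ i)) /=.
  apply: eq_bigl => T; apply/andP/idP => [[/andP[TA _] /eqP e]|TA].
    by rewrite -e -(setU1K iA) setSD.
  have iT : i \notin T by exact: (contra (subsetP TA i) iA).
  by rewrite setUS // setU11 setU1K.
by move=> T /andP[_ iT]; rewrite setD1K.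
Qed.

(** The first summand collects the cells on which inequality i is tight, the second those on which
    it is strict; a strict inequality does not enter the rank. *)
Lemma cone_eulerU1 s E A i : i \notin A ->
  cone_euler s E (i |: A) = cone_euler s (i |: E) A +
   \sum_(T : {set 'I_m} | T \subset A)
    (realized s (E :|: (A :\: T)) (i |: T))%:R *
      (-1) ^+ \rank (row_span (E :|: (A :\: T))).
Proof.
move=> iA; rewrite /cone_euler big_subset_setU1 // big_split /=.
congr (_ + _); apply: eq_bigr => T TA.
  have iT : i \notin T by exact: (contra (subsetP TA i) iA).
  have -> // : E :|: ((i |: A) :\: T) = i |: E :|: (A :\: T).
  rewrite setDUl (_ : [set i] :\: T = [set i]) 1?setUCA ?setUA //.
  by apply/setDidPl; rewrite disjoints1.
have -> // : (i |: A) :\: (i |: T) = A :\: T.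
rewrite setDUl -!setDDl setDv set0D set0U; congr (_ :\: _).
by apply/setDidPl; rewrite disjoint_sym disjoints1.
Qed.

Lemma cell_perturb s Z T u w : cell s Z T u -> (forall i, i \in Z ->
  row_val w i = 0) ->
  exists t : R, 0 < t /\ cell s Z T (u + t *: w) /\ cell s Z T (u + (- t) *: w).
Proof.
move=> [uZ uT] wZ.
have [t [t0 ht]] : exists t : R, 0 < t /\
    forall i, i \in T -> t * `|signed_val s w i| < signed_val s u i.
  (* A step of length [f i] keeps inequality i strict; the [+ 1] avoids a zero denominator, and the
     default 1 of the minimum below covers an empty T. *)
  pose f i := signed_val s u i / (`|signed_val s w i| + 1).
  have f0 i : i \in T -> 0 < f i by move=> /uT h; rewrite divr_gt0 // ltr_wpDl.
  exists (\big[Num.min/1]_(i in T) f i); split.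
    by elim/big_ind: _ => // x y x0 y0; rewrite lt_min x0.
  move=> i iT; apply: (@le_lt_trans _ _ (f i * `|signed_val s w i|)).
    by rewrite ler_wpM2r // bigmin_le_cond.
  by rewrite /f mulrAC ltr_pdivrMr ?ltr_wpDl // ltr_pM2l ?uT // ltrDl.
exists t; split=> //.
have key (t' : R) : `|t'| = t -> cell s Z T (u + t' *: w).
  move=> nt; split=> i iZ;
    first by rewrite row_valD row_valZ uZ ?wZ // mulr0 addr0.
  rewrite signed_valD signed_valZ; have := ht i iZ;
    rewrite -nt -normrM ltr_norml.
  by case/andP => h _; rewrite addrC -ltrBlDr sub0r.
by split; apply: key; rewrite ?normrN gtr0_norm.
Qed.

Definition flip s i : 'I_m -> bool := fun j => (j == i) (+) s j.

Lemma signed_val_flip s i u j : j != i ->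
  signed_val (flip s i) u j = signed_val s u j.
Proof. by rewrite /signed_val /flip => /negPf ->. Qed.

Lemma signed_val_flip1 s i u : signed_val (flip s i) u i = - signed_val s u i.
Proof. by rewrite /signed_val /flip eqxx /= signrN mulNr. Qed.

Lemma cell_flip s i Z T u : i \notin T ->
  cell (flip s i) Z T u <-> cell s Z T u.
Proof.
move=> iT; split=> -[H1 H2]; split=> // j jT; move: (H2 j jT);
  by rewrite signed_val_flip //; apply: contraNneq iT => <-.
Qed.

Lemma cellU1 s Z i T u : cell s Z (i |: T) u <-> cell s Z T u /\
  0 < signed_val s u i.
Proof.
split=> [[H1 H2]|[[H1 H2] H3]].
  split; last by apply: H2; rewrite setU11.
  by split=> // j jT; apply: H2; rewrite in_setU1 jT orbT.
by split=> // j; rewrite in_setU1 => /predU1P[->|/H2].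
Qed.

Lemma cellZU1 s Z i T u : cell s (i |: Z) T u <-> cell s Z T u /\
  row_val u i = 0.
Proof.
split=> [[H1 H2]|[[H1 H2] H3]].
  split; last by apply: H1; rewrite setU11.
  by split=> // j jT; apply: H1; rewrite in_setU1 jT orbT.
by split=> // j; rewrite in_setU1 => /predU1P[->|/H1].
Qed.

Lemma cellD s Z T u w : cell s Z T u -> cell s Z T w -> cell s Z T (u + w).
Proof.
move=> [u1 u2] [w1 w2]; split=> i iZ.
  by rewrite row_valD u1 // w1 // addr0.
by rewrite signed_valD addr_gt0 ?u2 ?w2.
Qed.

Lemma cellZ s Z T (t : R) u : 0 < t -> cell s Z T u -> cell s Z T (t *: u).
Proof.
move=> t0 [u1 u2]; split=> i iZ; first by rewrite row_valZ u1 // mulr0.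
by rewrite signed_valZ mulr_gt0 ?u2.
Qed.

(** The hyperplane of row i cuts a relatively open cell. If row i depends on Z, the cell lies in the
    hyperplane and only the tight piece remains. Otherwise the tight piece has rank one higher: if
    the hyperplane meets the cell, all three pieces occur and 1 + 1 - 1 = 1; if it misses the cell,
    convexity leaves exactly one side. *)
Lemma cell_split s i Z T : i \notin T ->
  (realized s Z (i |: T))%:R * (-1) ^+ \rank (row_span Z) +
  (realized (flip s i) Z (i |: T))%:R * (-1) ^+ \rank (row_span Z) +
  (realized s (i |: Z) T)%:R * (-1) ^+ \rank (row_span (i |: Z)) =
  (realized s Z T)%:R * (-1) ^+ \rank (row_span Z) :> int.
Proof.
move=> iT.
have fl u : cell (flip s i) Z (i |: T) u <-> cell s Z T u /\
  signed_val s u i < 0.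
  by rewrite cellU1 cell_flip // signed_val_flip1 oppr_gt0.
have [ri|/row_nsub_separated[rk [w [wZ wi]]]] := boolP (row i V <= row_span
  Z)%MS.
  have c0 u : cell s Z T u -> row_val u i = 0.
    by case=> uZ _; apply: row_sub_kills ri uZ.
  have s0 u : cell s Z T u -> signed_val s u i = 0.
    by move=> /c0 h; apply/eqP; rewrite signed_val_eq0 h.
  have -> : realized s Z (i |: T) = false.
    by apply/asboolP => -[u /cellU1[/s0 ->]]; rewrite ltxx.
  have -> : realized (flip s i) Z (i |: T) = false.
    by apply/asboolP => -[u /fl[/s0 ->]]; rewrite ltxx.
  rewrite row_sub_rank // !mul0r !add0r; congr ((nat_of_bool _)%:R * _).
  by apply: asbool_equiv_eq; split=> -[u]; [case/cellZU1; exists u|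
    move=> uc; exists u; apply/cellZU1; split=> //; apply: c0].
rewrite rk exprS; set e := (-1) ^+ \rank _.
have [r0|nr0] := boolP (realized s (i |: Z) T).
  have [u /cellZU1[uc ui]] := asboolW r0.
  have [t [t0 [cp cm]]] := cell_perturb uc wZ.
  have sp : signed_val s (u + t *: w) i = (-1) ^+ s i * t.
    by rewrite /signed_val row_valD row_valZ ui wi add0r mulr1.
  have sm : signed_val s (u + (- t) *: w) i = - ((-1) ^+ s i * t).
    by rewrite /signed_val row_valD row_valZ ui wi add0r mulr1 mulrN.
  have -> : realized s Z T by apply/asboolP; exists u.
  have -> : realized s Z (i |: T).
    apply/asboolP; move: sp sm; case: (s i) => /=;
      rewrite ?expr1 ?expr0 ?mulN1r ?mul1r ?opprK => sp sm.
      by exists (u + (- t) *: w); apply/cellU1; rewrite sm.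
    by exists (u + t *: w); apply/cellU1; rewrite sp.
  have -> : realized (flip s i) Z (i |: T).
    apply/asboolP; move: sp sm; case: (s i) => /=;
      rewrite ?expr1 ?expr0 ?mulN1r ?mul1r ?opprK => sp sm.
      by exists (u + t *: w); apply/fl; rewrite sp oppr_lt0.
    by exists (u + (- t) *: w); apply/fl; rewrite sm oppr_lt0.
  by rewrite !mul1r mulN1r addrK.
rewrite mul0r addr0 -mulrDl; congr (_ * _).
have [rp|nrp] := boolP (realized s Z (i |: T)).
  have [u /cellU1[uc ui]] := asboolW rp.
  have -> : realized s Z T by apply/asboolP; exists u.
  case: (boolP (realized _ _ _)) => // rm.
  have [u' /fl[uc' ui']] := asboolW rm.
  case/negP: nr0; apply/asboolP.
  (* A positive combination of points on both sides, weighted so that the values at row i cancel. *)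
  exists ((- signed_val s u' i) *: u + signed_val s u i *: u'); apply/cellZU1;
    split.
    by apply: cellD; apply: cellZ; rewrite ?oppr_gt0.
  by apply/eqP; rewrite -(signed_val_eq0 s) signed_valD !signed_valZ mulNr
    mulrC addNr.
rewrite add0r; congr (_%:R : int); congr (nat_of_bool _).
apply: asbool_equiv_eq; split=> [[u /fl[uc _]]|[u uc]]; first by exists u.
exists u; apply/fl; split=> //;
  case: (ltgtP (signed_val s u i) 0) => // [ui|ui].
  by case/negP: nrp; apply/asboolP; exists u; apply/cellU1.
case/negP: nr0; apply/asboolP; exists u; apply/cellZU1; split=> //.
by apply/eqP; rewrite -(signed_val_eq0 s) ui.
Qed.

Lemma cone_euler_flip_out s E A i : i \notin A ->
  cone_euler (flip s i) E A = cone_euler s E A.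
Proof.
move=> iA; apply: eq_bigr => T TA; congr ((nat_of_bool _)%:R * _);
  apply: asbool_equiv_eq.
have iT : i \notin T by exact: (contra (subsetP TA i) iA).
by split=> -[u /(cell_flip _ _ _ iT)]; exists u.
Qed.

(** The two halves of the cone share the cells inside the hyperplane, which are therefore counted
    twice; the rest is [cell_split] summed over the cells. *)
Lemma cone_euler_flip s E A i : i \notin A ->
  cone_euler s E (i |: A) + cone_euler (flip s i) E (i |: A) =
  cone_euler s E A + cone_euler s (i |: E) A.
Proof.
move=> iA; rewrite !cone_eulerU1 //.
rewrite cone_euler_flip_out //.
suff -> : cone_euler s E A = cone_euler s (i |: E) A +
    \sum_(T : {set 'I_m} | T \subset A)
      (realized s (E :|: (A :\: T)) (i |: T))%:R *
        (-1) ^+ \rank (row_span (E :|: (A :\: T))) +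
    \sum_(T : {set 'I_m} | T \subset A)
      (realized (flip s i) (E :|: (A :\: T)) (i |: T))%:R *
        (-1) ^+ \rank (row_span (E :|: (A :\: T))) by ring.
rewrite -addrA addrC /cone_euler -!big_split /=; apply: eq_bigr => T TA.
by rewrite -setUA cell_split //; exact: (contra (subsetP TA i) iA).
Qed.

Definition in_cone s E A u : Prop :=
  (forall i, i \in E -> row_val u i = 0) /\ (forall i, i \in A ->
    0 <= signed_val s u i).

(** The cone is not a linear subspace: the negative of [u] violates inequality i. Otherwise all
    inequalities are equalities on the cone. *)
Definition nonlinear s E A : Prop :=
  exists u i, [/\ in_cone s E A u, i \in A & 0 < signed_val s u i].

Lemma in_coneU1 s E A i u :
  in_cone s E (i |: A) u <-> in_cone s E A u /\ 0 <= signed_val s u i.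
Proof.
split=> [[H1 H2]|[[H1 H2] H3]].
  split; last by apply: H2; rewrite setU11.
  by split=> // j jT; apply: H2; rewrite in_setU1 jT orbT.
by split=> // j; rewrite in_setU1 => /predU1P[->|/H2].
Qed.

Lemma in_coneEU1 s E A i u :
  in_cone s (i |: E) A u <-> in_cone s E A u /\ row_val u i = 0.
Proof.
split=> [[H1 H2]|[[H1 H2] H3]].
  split; last by apply: H1; rewrite setU11.
  by split=> // j jT; apply: H1; rewrite in_setU1 jT orbT.
by split=> // j; rewrite in_setU1 => /predU1P[->|/H1].
Qed.

Lemma in_cone_flip s E A i u : i \notin A ->
  in_cone (flip s i) E A u <-> in_cone s E A u.
Proof.
move=> iA; split=> -[H1 H2]; split=> // j jT; move: (H2 j jT);
  by rewrite signed_val_flip //; apply: contraNneq iA => <-.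
Qed.

Lemma in_coneDZ s E A u w (a b : R) : 0 <= a -> 0 <= b ->
  in_cone s E A u -> in_cone s E A w -> in_cone s E A (a *: u + b *: w).
Proof.
move=> a0 b0 [u1 u2] [w1 w2]; split=> i iZ.
  by rewrite row_valD !row_valZ u1 // w1 // !mulr0 addr0.
by rewrite signed_valD !signed_valZ addr_ge0 // mulr_ge0 ?u2 ?w2.
Qed.

Lemma realized_nonlinear s E A T :
  T \subset A -> T != set0 -> realized s (E :|: (A :\: T)) T -> nonlinear s E A.
Proof.
move=> TA /set0Pn[i iT] /asboolP[u [H1 H2]]; exists u, i; split.
- split=> j jE; first by apply: H1; rewrite in_setU jE.
  case: (boolP (j \in T)) => jT; first by rewrite ltW ?H2.
  by rewrite le_eqVlt eq_sym signed_val_eq0 H1 ?eqxx // !inE jT jE orbT.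
- exact: (subsetP TA).
- exact: H2.
Qed.

Lemma cone_euler_linear s E A : ~ nonlinear s E A ->
  cone_euler s E A = (-1) ^+ \rank (row_span (E :|: A)).
Proof.
move=> H; rewrite /cone_euler (bigD1 set0) ?sub0set //= setD0 big1 ?addr0.
  have -> : realized s (E :|: A) set0; last by rewrite mul1r.
  apply/asboolP; exists 0; split=> i; last by rewrite inE.
  by rewrite /row_val mulmx0 mxE.
move=> T /andP[TA T0]; case: (boolP (realized _ _ _)) => [r|_];
  last by rewrite mul0r.
by case: H; exact: realized_nonlinear TA T0 r.
Qed.

Definition euler_vanishes s E A := nonlinear s E A -> cone_euler s E A = 0.

(** In [cone_euler_flip] the three other terms are known: each vanishes, or its cone is a linear
    subspace and it is a sign by [cone_euler_linear]. The signs that occur cancel in pairs. *)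
Lemma vanish_flip s E A i : i \notin A ->
  euler_vanishes s E A -> euler_vanishes s (i |: E) A ->
  euler_vanishes s E (i |: A) -> euler_vanishes (flip s i) E (i |: A).
Proof.
move=> iA v0 v1 vp [u [j [/in_coneU1[/in_cone_flip-/(_ iA) uc]]]].
rewrite signed_val_flip1 oppr_ge0 => ui jA uj.
have := cone_euler_flip s E iA; case: (pselect (nonlinear s E A)) => n0.
  rewrite v0 // add0r; case: (pselect (nonlinear s (i |: E) A)) => [n1|n1].
    rewrite v1 // vp ?add0r //; case: n1 => z [k [/in_coneEU1[zc zi] kA zk]].
    exists z, k; split=> //; last by rewrite in_setU1 kA orbT.
    by apply/in_coneU1; rewrite /signed_val zi mulr0.
  have ui' : signed_val s u i < 0.
    rewrite lt_neqAle ui andbT; apply/eqP => u0; apply: n1; exists u, j.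
    have ji : j != i by apply: contraTneq uj => ->;
      rewrite signed_val_flip1 u0 oppr0 ltxx.
    rewrite signed_val_flip // in uj; split=> //.
      by apply/in_coneEU1; split=> //; apply/eqP;
        rewrite -(signed_val_eq0 s) u0.
    by move: jA; rewrite in_setU1 (negPf ji).
  (* The hyperplane section is linear, but the uncut cone has a point [z] strict at some [l]. Adding
     to it a multiple of [u] or [u'], whichever lies on the opposite side, gives a point of the
     section that is strict at [l]. So no such [u'] exists, and the original half equals the
     section, with the same rank. *)
  have np : ~ nonlinear s E (i |: A).
    case=> u' [k [/in_coneU1[uc' u'i] kA u'k]].
    have ui0 : 0 < signed_val s u' i.
      rewrite lt_neqAle u'i andbT eq_sym; apply/eqP => u0; apply: n1;
        exists u', k.
      split=> //; first by apply/in_coneEU1; split=> //; apply/eqP;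
        rewrite -(signed_val_eq0 s) u0.
      by move: kA; rewrite in_setU1 => /predU1P[e|//]; rewrite e u0 ltxx in u'k.
    case: n0 => z [l [zc lA zl]].
    have key w (a b : R) : 0 < a -> 0 <= b -> in_cone s E A w ->
        signed_val s (a *: z + b *: w) i = 0 -> False.
      move=> a0 b0 wc e; apply: n1; exists (a *: z + b *: w), l; split=> //.
        apply/in_coneEU1; split; first by apply: in_coneDZ => //; apply: ltW.
        by apply/eqP; rewrite -(signed_val_eq0 s) e.
      rewrite signed_valD !signed_valZ; apply: ltr_pwDl; first exact: mulr_gt0.
      by apply: mulr_ge0 => //; exact: (proj2 wc).
    case: (leP 0 (signed_val s z i)) => zi.
      apply: (key u (- signed_val s u i) (signed_val s z i));
        rewrite ?oppr_gt0 //.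
      by rewrite signed_valD !signed_valZ mulNr [X in _ + X]mulrC addNr.
    apply: (key u' (signed_val s u' i) (- signed_val s z i));
      rewrite ?oppr_ge0 ?(ltW zi) //.
    by rewrite signed_valD !signed_valZ mulNr [X in _ - X]mulrC addrN.
  rewrite (cone_euler_linear np) (cone_euler_linear n1) setUCA setUA => /eqP.
  by rewrite addrC eq_sym -subr_eq subrr eq_sym => /eqP.
have zA k : k \in A -> signed_val s u k = 0.
  move=> kA; apply/eqP; rewrite eq_le; case: (uc) => _ h; rewrite h // andbT.
  by rewrite leNgt; apply/negP => uk; apply: n0; exists u, k.
have ui' : signed_val s u i < 0.
  move: jA uj; rewrite in_setU1 => /predU1P[->|jA];
    first by rewrite signed_val_flip1 oppr_gt0.
  by rewrite signed_val_flip ?(memPn iA) // zA // ltxx.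
(* The uncut cone is now a linear subspace, so [- u], written as a combination, lies in the original
   half and makes it nonlinear. The two linear cones left over have ranks differing by one, as [u]
   does not vanish on row i. *)
rewrite vp; last first.
  exists (- 1 *: u + 0 *: u), i; split; rewrite ?setU11 //.
    apply/in_coneU1; split;
      last by rewrite signed_valD !signed_valZ mul0r addr0 mulN1r oppr_ge0 ltW.
    split=> k kE; last by rewrite signed_valD !signed_valZ zA // !mulr0 addr0.
    by rewrite row_valD !row_valZ; case: (uc) => -> // _; rewrite !mulr0 addr0.
  by rewrite signed_valD !signed_valZ mul0r addr0 mulN1r oppr_gt0.
have n1 : ~ nonlinear s (i |: E) A.
  by case=> z [k [/in_coneEU1[zc _] kA zk]]; apply: n0; exists z, k.
rewrite (cone_euler_linear n0) (cone_euler_linear n1) -setUA (proj1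
  (row_nsub_separated _)) ?exprS ?mulN1r ?subrr ?add0r //.
apply/negP => /row_sub_kills u0; move: ui';
  rewrite /signed_val u0 ?mulr0 ?ltxx //.
move=> k; rewrite in_setU => /orP[kE|/zA /eqP]; first by case: (uc) => ->.
by rewrite signed_val_eq0 => /eqP.
Qed.

Lemma vanish_flip_out s E A i : i \notin A ->
  euler_vanishes s E A -> euler_vanishes (flip s i) E A.
Proof.
move=> iA v [u [j [/in_cone_flip-/(_ iA) uc jA uj]]].
rewrite cone_euler_flip_out // v //; exists u, j; split=> //.
by move: uj; rewrite signed_val_flip // (memPn iA).
Qed.

Lemma flip_connected (P : ('I_m -> bool) -> Prop) s s' :
  (forall t i, P t -> P (flip t i)) -> P s -> P s'.
Proof.
move=> Pf Ps; pose st (r : seq 'I_m) i := if i \in r then s' i else s i.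
have -> : s' = st (enum 'I_m) by apply: funext => i; rewrite /st mem_enum.
elim: (enum 'I_m) => [|i r IH]; first exact: Ps.
have [e|e] := eqVneq (st r i) (s' i).
  suff -> : st (i :: r) = st r by [].
  by apply: funext => j; rewrite {1}/st inE; case: eqP => [->|].
suff -> : st (i :: r) = flip (st r) i by apply: Pf.
apply: funext => j; rewrite /flip {1}/st inE; case: eqP => [->|_] //.
by case: (st r i) e; case: (s' i).
Qed.

Theorem cone_euler_eq0 s E A : nonlinear s E A -> cone_euler s E A = 0.
Proof.
move: {2}#|A| (leqnn #|A|) => n; elim: n A s E => [|n IH] A s E.
  by rewrite leqn0 cards_eq0 => /eqP -> [u [i [_]]]; rewrite inE.
move=> An nl; have [i iA] : exists i, i \in A by case: nl => u [i [_ iA _]];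
  exists i.
rewrite -(setD1K iA) in An nl *; set B := A :\ i in An nl *.
have iB : i \notin B by rewrite !inE eqxx.
have Bn : (#|B| <= n)%N by rewrite cardsU1 iB in An.
have [ri|/row_nsub_separated[_ [w [wZ wi]]]] := boolP (row i V <= row_span (E
  :|: B))%MS; last first.
  (* Row i is independent of the others: moving along [w] turns a cell with i strict into one with i
     tight and conversely, and the ranks differ by one. *)
  rewrite cone_eulerU1 // /cone_euler -big_split big1 //= => T TB.
  have wZ' j : j \in E :|: (B :\: T) -> row_val w j = 0.
    by move=> jE; apply: wZ; apply: subsetP jE; rewrite setUS // subsetDl.
  have nr : ~~ (row i V <= row_span (E :|: (B :\: T)))%MS.
    apply/negP => /row_sub_kills /(_ wZ') /eqP; rewrite wi;
      exact/negP/oner_neq0.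
  have wT j : j \in T -> row_val w j = 0.
    by move=> jT; apply: wZ; rewrite in_setU (subsetP TB) ?orbT.
  have upd u (t : R) : cell s (E :|: (B :\: T)) T u ->
    cell s (E :|: (B :\: T)) T (u + t *: w).
    case=> H1 H2; split=> j jZ;
      first by rewrite row_valD row_valZ H1 // wZ' // mulr0 addr0.
    by rewrite signed_valD signed_valZ [signed_val s w j]/signed_val wT //
      !mulr0 addr0 H2.
  rewrite -setUA (proj1 (row_nsub_separated nr)) exprS mulN1r mulrN addrC.
  suff -> : realized s (E :|: (B :\: T)) (i |: T) =
    realized s (i |: (E :|: (B :\: T))) T.
    by rewrite subrr.
  apply: asbool_equiv_eq; split=> -[u].
    move=> /cellU1[uc _]; exists (u + (- row_val u i) *: w).
    apply/cellZU1; split; first exact: upd.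
    by rewrite row_valD row_valZ wi mulr1 subrr.
  move=> /cellZU1[uc ui]; exists (u + ((-1) ^+ s i) *: w); apply/cellU1;
    split; first exact: upd.
  by rewrite signed_valD signed_valZ /signed_val ui wi mulr0 add0r mulr1
    -expr2 sqrr_sign.
move: nl; rewrite -/(euler_vanishes s E (i |: B)).
(* Row i as a combination of the rows in B, modulo those in E, which vanish on the cone. *)
have [L HL] : exists L : 'I_m -> R, forall u, (forall j, j \in E ->
  row_val u j = 0) ->
    row_val u i = \sum_(j in B) L j * row_val u j.
  have /sub_sumsmxP[r rE] := ri.
  pose c j := (r j *m <<row j V>>)%MS.
  have /choice[L HL] : forall j, exists l : R, (r j *m <<row j V>>%MS) =
    l *: row j V.
    by move=> j; apply/sub_rVP; rewrite -(genmxE (row j V)) submxMl.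
  exists L => u uE; have := congr1 (fun M => (M *m u) 0 0) rE.
  rewrite /= -row_mul mxE -/(row_val u i) => ->.
  have term j : (r j *m <<row j V>>%MS *m u) 0 0 = L j * row_val u j.
    by rewrite HL -scalemxAl -row_mul mxE [row _ _ _ _]mxE.
  rewrite mulmx_suml summxE (bigID (mem E)) /= big1 ?add0r.
    rewrite [RHS](bigID (mem E)) /= [X in _ = X + _]big1 ?add0r.
      apply: eq_big => j; first by rewrite in_setU; case: (j \in E);
        rewrite ?andbF ?andbT.
      by move=> _; rewrite term.
    by move=> j /andP[_ jE]; rewrite uE ?mulr0.
  by move=> j /andP[_ jE]; rewrite term uE ?mulr0.
(* Orient the inequalities j in B against L j,
  so that they force row i to vanish. *)
pose s0 j := if j == i then false else (0 < L j).
have vs0 : euler_vanishes s0 E (i |: B).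
  have c0 u : in_cone s0 E (i |: B) u -> row_val u i = 0.
    move=> /in_coneU1[[uE uB] ui]; rewrite /signed_val /s0 eqxx mul1r in ui.
    apply/eqP; rewrite eq_le ui andbT HL //; apply: sumr_le0 => j jB.
    have := uB j jB; rewrite /signed_val /s0;
      have /negPf -> : j != i by apply: contraNneq iB => <-.
    case: (ltP 0 (L j)) => Lj; rewrite ?expr1 ?mulN1r ?oppr_ge0 ?mul1r => h.
      by rewrite pmulr_rle0.
    by rewrite mulr_le0_ge0.
  move=> [u [j [uc jB uj]]]; rewrite cone_eulerU1 // big1 ?addr0.
    apply: IH => //; exists u, j; split=> //.
      by apply/in_coneEU1; split; [have /in_coneU1[] := uc | apply: c0].
    move: jB; rewrite in_setU1 => /predU1P[e|//].
    by move: uj; rewrite e /signed_val c0 // mulr0 ltxx.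
  move=> T TB; have -> : realized s0 (E :|: B :\: T) (i |: T) = false;
    last by rewrite mul0r.
  apply/asboolP => -[z /cellU1[[zE zT] zi]].
  have : in_cone s0 E (i |: B) z.
    apply/in_coneU1; split; last exact: ltW.
    split=> k kE; first by apply: zE; rewrite in_setU kE.
    case: (boolP (k \in T)) => kT; first by rewrite ltW ?zT.
    by rewrite /signed_val zE ?mulr0 ?lexx // in_setU in_setD kT kE orbT.
  by move=> /c0; move: zi => /[swap] z0; rewrite /signed_val z0 mulr0 ltxx.
(* Each reversal requires the claim for two cones with one inequality less, where the inequality is
   dropped or made an equation; the induction hypothesis covers them in every orientation. *)
apply: (flip_connected (P := fun s => euler_vanishes s E (i |: B))) vs0 =>
  t j vt.
have [jA|jA] := boolP (j \in i |: B); last exact: vanish_flip_out.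
rewrite -(setD1K jA) in An vt *.
have jB : j \notin (i |: B) :\ j by rewrite !inE eqxx.
have Bn' : (#|(i |: B) :\ j| <= n)%N by rewrite cardsU1 jB in An.
by apply: vanish_flip => //; move=> h; apply: IH.
Qed.

End ConeEuler.

(* Imported only now, as classical_sets shadows lemmas on finite sets; Defs is
   imported again as [dim] would otherwise be the one of vector spaces. *)
From mathcomp Require Import freeg finmap.
From mathcomp Require Import classical_sets functions.
From mathcomp Require Import cardinality fsbigop reals.
Import Defs.
Local Open Scope classical_set_scope.
Local Open Scope ring_scope.

(** * Faces and dimension *)

Section Polytopes.
Variable R : realType.

Section Ambient.
Variable d : nat.
Implicit Types (A B F G : set 'rV[R]_d) (x y p : 'rV[R]_d) (u w : 'cV[R]_d).

Lemma dotpZ (t : R) x u : dotp (t *: x) u = t * dotp x u.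
Proof. by rewrite /dotp -scalemxAl mxE. Qed.

Lemma dotpB x y u : dotp (x - y) u = dotp x u - dotp y u.
Proof. by rewrite -[- y]scaleN1r dotpD dotpZ mulN1r. Qed.

Lemma dotpDr x u w : dotp x (u + w) = dotp x u + dotp x w.
Proof. by rewrite /dotp mulmxDr mxE. Qed.

Lemma dotpZr (t : R) x u : dotp x (t *: u) = t * dotp x u.
Proof. by rewrite /dotp -scalemxAr mxE. Qed.

Lemma dotpNr x u : dotp x (- u) = - dotp x u.
Proof. by rewrite -scaleN1r dotpZr mulN1r. Qed.

Lemma dotp_conv_le m (V : 'M[R]_(m, d)) u c x :
  (forall i, dotp (row i V) u <= c) -> conv V x -> dotp x u <= c.
Proof.
move=> H [a [a0 a1 ->]]; rewrite dotp_conv -[leRHS]mul1r -a1 mulr_suml.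
by apply: ler_sum => i _; rewrite ler_wpM2l.
Qed.

Lemma dotp_conv_eq m (V : 'M[R]_(m, d)) u c x :
  (forall i, dotp (row i V) u = c) -> conv V x -> dotp x u = c.
Proof.
move=> H [a [a0 a1 ->]]; rewrite dotp_conv -[RHS]mul1r -a1 mulr_suml.
by apply: eq_bigr => i _; rewrite H.
Qed.

Lemma conv_convex m (V : 'M[R]_(m, d)) x y (t : R) : 0 <= t <= 1 ->
  conv V x -> conv V y -> conv V ((1 - t) *: x + t *: y).
Proof.
move=> /andP[t0 t1] [a [a0 a1 ->]] [b [b0 b1 ->]].
exists ((1 - t) *: a + t *: b); split.
- by move=> i; rewrite !mxE addr_ge0 ?mulr_ge0 ?subr_ge0.
- under eq_bigr do rewrite !mxE.
  by rewrite big_split /= -!mulr_sumr a1 b1 !mulr1 subrK.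
- by rewrite mulmxDl !scalemxAl.
Qed.

Lemma has_indepS A B r : A `<=` B -> has_indep A r -> has_indep B r.
Proof. by move=> AB [x [M [h1 h2 h3]]]; exists x, M; split=> // [|i];
  apply: AB. Qed.

Lemma dimS A B : A !=set0 -> A `<=` B -> (dim A <= dim B)%N.
Proof. by move=> A0 AB; apply/dim_ge/(has_indepS AB)/dim_indep. Qed.

Lemma dim_le_rank A x m (B : 'M[R]_(m, d)) : A !=set0 ->
  (forall y, A y -> (y - x <= B)%MS) -> (dim A <= \rank B)%N.
Proof.
move=> /dim_indep [x0 [M [Ax0 AM /eqP <-]]] H; apply/mxrankS/row_subP => i.
have -> : row i M = (x0 + row i M - x) - (x0 - x) by rewrite opprB addrA
  subrK addrC addKr.
by apply: addmx_sub; rewrite ?eqmx_opp; apply: H.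
Qed.

Lemma rank_le_dim A x m (B : 'M[R]_(m, d)) : A x ->
  (forall i, A (x + row i B)) -> (\rank B <= dim A)%N.
Proof.
move=> Ax H; apply: dim_ge; exists x, (rowsub (maxrankfun B) B).
by split=> // [i|]; rewrite ?row_rowsub ?maxrowsub_free.
Qed.

(** By maximality: a point of A outside the span could be appended to the family and would raise the
    dimension. *)
Lemma dim_basis A : A !=set0 ->
  exists x (M : 'M[R]_(dim A, d)),
    [/\ A x, forall i, A (x + row i M), row_free M &
        forall y, A y -> (y - x <= M)%MS].
Proof.
move=> A0; have [x [M [Ax AM fM]]] := dim_indep A0; exists x, M;
  split=> // y Ay.
apply/negPn/negP => nyM.
suff : has_indep A (dim A + 1) by move/dim_ge; rewrite addn1 ltnn.
exists x, (col_mx M (y - x)); split=> // [i|].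
  case: (split_ordP i) => j ->; first by rewrite rowKu.
  by rewrite rowKd [j]ord1 row_id addrC subrK.
rewrite /row_free eqn_leq rank_leq_row /=.
apply: (@leq_trans (\rank M).+1); first by rewrite (eqP fM) addn1.
rewrite ltn_neqAle -addsmxE mxrankS ?addsmxSl // andbT.
apply: contra nyM => /eqP e.
have := mxrank_leqif_sup (addsmxSl M (y - x)).
rewrite /leqif e eqxx => -[_ /esym].
by apply: submx_trans; rewrite addsmxSr.
Qed.

Lemma submx_sep m (M : 'M[R]_(m, d)) x : ~~ (x <= M)%MS ->
  exists u, M *m u = 0 /\ dotp x u = 1.
Proof.
rewrite submxE => /eqP H.
have [k Hk] : exists k, (x *m cokermx M) 0 k != 0.
  apply: contrapT => /forallNP Hn; apply: H; apply/matrixP => a b.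
  by rewrite ord1 [RHS]mxE; apply/eqP/negPn/negP/Hn.
set u := col k (cokermx M).
have ui : dotp x u = (x *m cokermx M) 0 k.
  by rewrite /dotp /u colE mulmxA -colE mxE.
exists ((dotp x u)^-1 *: u); split; last by rewrite dotpZr mulVf // ui.
by rewrite -scalemxAr /u colE mulmxA mulmx_coker mul0mx scaler0.
Qed.

Lemma faces_sub A F : faces A F -> F `<=` A.
Proof. by move=> [_ [u [c [_ ->]]]] x []. Qed.

Lemma faces_nonempty A F : faces A F -> F !=set0.
Proof. by case. Qed.

Lemma faces_self A : A !=set0 -> faces A A.
Proof.
move=> A0; split=> //; exists 0, 0; split=> [x _|];
  first by rewrite /dotp mulmx0 mxE.
by apply/seteqP; split=> x /= => [Ax|[]//]; rewrite /dotp mulmx0 mxE.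
Qed.

Lemma face_dim_le A F : faces A F -> (dim F <= dim A)%N.
Proof. by move=> FA; apply: dimS (faces_nonempty FA) (faces_sub FA). Qed.

Lemma face_dim_lt A F : faces A F -> F <> A -> (dim F < dim A)%N.
Proof.
move=> FA nFA; rewrite ltn_neqAle face_dim_le // andbT.
by apply/eqP => /(face_dim_eq FA).
Qed.

Lemma sub_face A F G : faces A F -> faces A G -> G `<=` F -> faces F G.
Proof.
move=> [F0 [u [c [uc FE]]]] [G0 [w [b [wb GE]]]] GF; split=> //; exists w, b;
  split.
  by move=> x Fx; apply: wb; rewrite FE in Fx; case: Fx.
apply/seteqP; split=> x /=; first by move=> Gx; split;
  [apply: GF|rewrite GE in Gx; case: Gx].
by case=> Fx e; rewrite GE; split=> //; rewrite FE in Fx; case: Fx.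
Qed.

(* Tilt the functional exposing F, steeply enough, by the one exposing G. *)
Lemma face_trans A F G : is_polytope A -> faces A F -> faces F G -> faces A G.
Proof.
move=> [_ [m [V AE]]] [F0 [u [c [uc FE]]]] [G0 [w [b [wb GE]]]]; split=> //.
pose N := \sum_(i | dotp (row i V) u != c) `|dotp (row i V) w - b| / (c -
  dotp (row i V) u).
have rA i : A (row i V) by rewrite AE; apply: row_conv.
have le_N x : A x -> dotp x (N *: u + w) <= N * c + b.
  rewrite {1}AE; apply: dotp_conv_le => i; rewrite dotpDr dotpZr.
  have [e|ne] := eqVneq (dotp (row i V) u) c.
    by rewrite e lerD2l wb // FE.
  have dc : 0 < c - dotp (row i V) u by rewrite subr_gt0 lt_neqAle ne uc.
  suff : dotp (row i V) w - b <= N * (c - dotp (row i V) u) by lra.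
  rewrite -ler_pdivrMr // /N (bigD1 i) //=.
  rewrite (le_trans (y := `|dotp (row i V) w - b| / (c - dotp (row i V) u))) //.
    by rewrite ler_pM2r ?invr_gt0 // ler_norm.
  by rewrite lerDl sumr_ge0 // => j _; rewrite divr_ge0 // subr_ge0 uc.
(* Slope N makes the bound hold on A; one more unit makes it strict off F. *)
have E x : dotp x ((N + 1) *: u + w) = dotp x (N *: u + w) + dotp x u.
  by rewrite !dotpDr !dotpZr mulrDl mul1r addrAC.
exists ((N + 1) *: u + w), ((N + 1) * c + b); split.
  by move=> x Ax; rewrite E; have := le_N x Ax; have := uc x Ax; lra.
apply/seteqP; split=> x /=.
  rewrite GE FE /= => -[[Ax ux] wx]; split=> //.
  by rewrite dotpDr dotpZr ux wx.
case=> Ax; rewrite E => e.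
have ux : dotp x u = c by have := le_N x Ax; have := uc x Ax; move: e; lra.
by rewrite GE FE /=; split=> //; move: e; rewrite dotpDr dotpZr ux; lra.
Qed.

End Ambient.
End Polytopes.

(** * Euler's relation for intervals of the face lattice *)

Section IntervalEuler.
Variables (R : realType) (d : nat).
Implicit Types (A F G : set 'rV[R]_d).

Lemma is_polytope_nonempty A : is_polytope A -> A !=set0.
Proof. by case. Qed.

(* The barycenter of the generators of G is a relative interior point of G. *)
Lemma relint_point A G : is_polytope A -> faces A G ->
  exists x, G x /\ forall F, faces A F -> F x -> G `<=` F.
Proof.
move=> Ap GA; have [[y Gy] [m [V GE]]] := face_polytope Ap GA.
have m0 : (m%:R : R) != 0.
  rewrite pnatr_eq0; apply/eqP => m0; subst m; move: Gy; rewrite GE.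
  by case=> a [_ + _]; rewrite big_ord0 => /esym /eqP; rewrite oner_eq0.
pose a : 'rV[R]_m := const_mx (m%:R^-1).
have Ga : conv V (a *m V).
  exists a; split=> //; first by move=> i; rewrite mxE invr_ge0 ler0n.
  under eq_bigr do rewrite mxE.
  by rewrite sumr_const card_ord -(mulr_natr m%:R^-1) mulVf.
exists (a *m V); split; first by rewrite GE.
move=> F [_ [u [c [uc FE]]]]; rewrite FE /= => -[Aa ac] z Gz.
have uV i : dotp (row i V) u <= c.
  by apply: uc; apply: (faces_sub GA); rewrite GE; exact: row_conv.
split; first exact: (faces_sub GA).
move: Gz; rewrite GE; apply: dotp_conv_eq => i.
apply/eqP; rewrite -subr_eq0 -oppr_eq0 opprB.
have s0 : \sum_j (c - dotp (row j V) u) = 0.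
  rewrite sumrB sumr_const card_ord -(mulr_natl c); apply/eqP;
    rewrite subr_eq0; apply/eqP.
  move: ac; rewrite dotp_conv => <-; rewrite mulr_sumr; apply: eq_bigr => j _.
  by rewrite mxE mulrA mulfV // mul1r.
move/eqP: s0; rewrite psumr_eq0 => [|j _]; last by rewrite subr_ge0.
by move=> /allP /(_ i (mem_index_enum _)).
Qed.

Lemma row_spanP m (V : 'M[R]_(m, d)) (T : {set 'I_m}) n (B : 'M[R]_(n, d)) :
  (row_span V T <= B)%MS <-> (forall i, i \in T -> (row i V <= B)%MS).
Proof.
split=> [h i iT|h].
  by apply: submx_trans h; apply: (sumsmx_sup i) => //; rewrite genmxE.
by apply/sumsmx_subP => i iT; rewrite genmxE h.
Qed.

(** Let [x] be a relative interior point of G. The cells of the normal cone at [x] correspond to the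
    faces containing [x], which are those containing G. The strict inequalities of a cell mark the
    generators off its face, and the codimension of the cell is the dimension of the face. *)
Theorem euler_interval A G : is_polytope A -> faces A G -> G <> A ->
  \sum_(F \in [set F | faces A F /\ G `<=` F]) ((-1) ^+ dim F : int) = 0.
Proof.
move=> Ap GA nGA; have [x [Gx xG]] := relint_point Ap GA.
have Ax := faces_sub GA Gx.
have [_ [m [V AE]]] := Ap.
have AV i : A (row i V) by rewrite AE; apply: row_conv.
pose W : 'M[R]_(m, d) := \matrix_i (x - row i V).
have valW u i : row_val W u i = dotp x u - dotp (row i V) u.
  by rewrite /row_val -dotp_row rowK dotpB.
pose s (i : 'I_m) := false.
have svalW u i : signed_val W s u i = dotp x u - dotp (row i V) u.
  by rewrite /signed_val expr0 mul1r valW.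
pose FT (T : {set 'I_m}) := conv (rowsub (enum_val : 'I_#|T| -> _) V).
have cellE u T : cell W s (~: T) T u ->
    (forall y, A y -> dotp y u <= dotp x u) /\
    FT (~: T) = [set y | A y /\ dotp y u = dotp x u].
  case=> uZ uT.
  have le y : A y -> dotp y u <= dotp x u.
    rewrite AE; apply: dotp_conv_le => i; rewrite -subr_ge0 -valW.
    have [iT|iT] := boolP (i \in T); last by rewrite uZ ?inE.
    by rewrite valW -svalW ltW // uT.
  split=> //; rewrite AE in le *; rewrite conv_face // /FT.
  suff -> : (~: T)%SET = [set i | dotp (row i V) u == dotp x u]%SET by [].
  apply/setP => i; rewrite !inE; apply/idP/idP => [iT|/eqP e].
    by rewrite eq_sym -subr_eq0 -valW uZ ?inE.
  by apply/negP => /uT; rewrite svalW e subrr ltxx.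
have realW T : realized W s (~: T) T -> faces A (FT (~: T)) /\ G `<=` FT (~: T).
  move=> /asboolP[u /cellE[le E]].
  have f : faces A (FT (~: T)).
    by split; [exists x; rewrite E | exists u, (dotp x u)].
  by split=> //; apply: xG => //; rewrite E.
have rowF T i : realized W s (~: T) T ->
  FT (~: T) (row i V) <-> i \in (~: T)%SET.
  move=> /asboolP[u uc]; have [_ ->] := cellE _ _ uc; case: uc => uZ uT.
  split=> [[_ e]|iT].
    by rewrite inE; apply/negP => /uT; rewrite svalW e subrr ltxx.
  by split=> //; apply/esym/eqP; rewrite -subr_eq0 -valW uZ.
have dimF T : realized W s (~: T) T ->
  dim (FT (~: T)) = \rank (row_span W (~: T)).
  move=> rT; have [FA GF] := realW T rT.
  apply/eqP; rewrite eqn_leq; apply/andP; split.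
    apply: (dim_le_rank (x := x)); first by exists x; apply: GF.
    move=> y [a [_ a1 ->]].
    have -> : a *m rowsub enum_val V - x = - \sum_i a 0 i *: row (enum_val i) W.
      rewrite mulmx_sum_row -{1}[x]scale1r -a1 scaler_suml -sumrB -sumrN.
      apply: eq_bigr => i _; rewrite row_rowsub rowK -scalerBr -scalerN.
      by rewrite opprB.
    rewrite eqmx_opp; apply: summx_sub => i _; apply: scalemx_sub.
    by apply: (proj1 (row_spanP _ _ _) (submx_refl _)); apply: enum_valP.
  pose B := rowsub (enum_val : 'I_#|~: T| -> _) (- W).
  apply: (@leq_trans (\rank B)).
    apply: mxrankS; apply/row_spanP => i iT.
    have -> : row i W = - row (enum_rank_in iT i) B.
      by rewrite row_rowsub enum_rankK_in // linearN opprK.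
    by rewrite eqmx_opp row_sub.
  apply: (rank_le_dim (x := x)); first exact: GF.
  move=> i; rewrite row_rowsub linearN /= rowK opprB addrC subrK.
  by apply/rowF => //; apply: enum_valP.
(* As G is proper, the functional exposing it is strict at some generator. *)
have nl : nonlinear W s finset.set0 [set: 'I_m]%SET.
  have [_ [u [c [uc GE]]]] := GA.
  have ux : dotp x u = c by move: Gx; rewrite GE => -[].
  have [i ui] : exists i, dotp (row i V) u != c.
    apply: contrapT => /forallNP h; apply: nGA; rewrite GE; apply/seteqP;
      split=> y /= => [[]//|Ay].
    split=> //; move: Ay; rewrite AE; apply: dotp_conv_eq => i.
    by apply/eqP/negPn/negP/h.
  exists u, i; rewrite inE; split=> //.
    by split=> j; rewrite ?inE // => _; rewrite svalW ux subr_ge0 uc.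
  by rewrite svalW ux subr_gt0 lt_neqAle ui uc.
rewrite -[RHS](cone_euler_eq0 nl) /cone_euler.
transitivity (\sum_(T in [pred T | realized W s (~: T) T]) ((-1) ^+ \rank
  (row_span W (~: T)) : int)).
  rewrite [RHS]bigfs; [|exact: index_enum_uniq|by move=> i;
    rewrite mem_index_enum].
  rewrite (reindex_fsbig (fun T =>
    FT (~: T)%SET) [set` [pred T | realized W s (~: T) T]]).
    by apply: eq_fsbigr => T; rewrite inE /= => /dimF ->.
  split.
  - by move=> T /= /realW.
  - move=> T T'; rewrite !inE /= => rT rT' e; apply: finset.setC_inj;
      apply/setP => i.
    have := rowF T i rT; have := rowF T' i rT'; rewrite e => h1 h2.
    by apply/idP/idP => [/h2/h1|/h1/h2].
  - move=> F [FA GF]; have [_ [u [c [uc FE]]]] := FA.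
    have ux : dotp x u = c by move: (GF x Gx); rewrite FE => -[].
    exists [set i | dotp (row i V) u != c]%SET.
      apply/asboolP; exists u; split=> i; rewrite !inE ?negbK => h.
        by rewrite valW (eqP h) ux subrr.
      by rewrite svalW ux subr_gt0 lt_neqAle h uc.
    rewrite /= FE AE in uc *; rewrite conv_face // /FT.
    suff -> : (~: [set i | dotp (row i V) u != c])%SET =
      [set i | dotp (row i V) u == c]%SET by [].
    by apply/setP => i; rewrite !inE negbK.
rewrite big_mkcond [RHS]big_mkcond /=; apply: eq_bigr => T _.
rewrite finset.subsetT finset.set0U finset.setTD inE /=.
by case: realized; rewrite ?mul1r ?mul0r.
Qed.

End IntervalEuler.

(** * Facets and combinatorial invariance *)

Section Facets.
Variables (R : realType) (d : nat).
Implicit Types (A F G : set 'rV[R]_d).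

(** The maxima of a functional that is not constant on A form such a face. *)
Lemma proper_face_exists A : is_polytope A -> (0 < dim A)%N ->
  exists F, faces A F /\ F <> A.
Proof.
move=> [A0 [m [V AE]]] dA; have [x [M [Ax AM fM _]]] := dim_basis A0.
pose i0 := Ordinal dA.
have [u [_ u1]] : exists u, (0 : 'M[R]_(1, d)) *m u =
  0 /\ dotp (row i0 M) u = 1.
  apply: submx_sep; apply/negP => /submx0null e.
  have /row_freePn := fM; apply; exists i0.
  by rewrite e sub0mx.
have [j0] : inhabited 'I_m.
  case: m V AE => [|m] V AE; last by exists; exact: ord0.
  move: Ax; rewrite AE => -[a [_]]; rewrite big_ord0 => /esym/eqP.
  by rewrite oner_eq0.
have [j _ jmax] := @arg_maxP _ _ _ j0 xpredT (fun i => dotp (row i V) u) isT.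
have Aj : A (row j V) by rewrite AE; apply: row_conv.
exists [set y | A y /\ dotp y u = dotp (row j V) u]; split.
  split; first by exists (row j V).
  exists u, (dotp (row j V) u); split=> // y; rewrite AE.
  by apply: dotp_conv_le => i; apply: jmax.
move=> E; have cst y : A y ->
  dotp y u = dotp (row j V) u by rewrite -{1}E => -[].
have : dotp (x + row i0 M) u = dotp x u by rewrite !cst.
by rewrite dotpD u1 => /eqP; rewrite -subr_eq0 addrC addKr oner_eq0.
Qed.

(* Rotate the hyperplane exposing F about F until it meets another generator. *)
Lemma bigger_face A F : is_polytope A -> faces A F -> ((dim F).+1 < dim A)%N ->
  exists F', [/\ faces A F', F' <> A & (dim F < dim F')%N].
Proof.
move=> Ap FA dFA; have [_ [m [V AE]]] := Ap.
have [F0 [u [c [uc FE]]]] := FA.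
have AV i : A (row i V) by rewrite AE; apply: row_conv.
have [x [M [Fx FM fM spanM]]] := dim_basis F0.
have Ax := faces_sub FA Fx.
have ux : dotp x u = c by move: Fx; rewrite FE => -[].
have [y1 [Ay1 uy1]] : exists y, A y /\ dotp y u <> c.
  apply: contrapT => /forallNP h; move: dFA;
    suff -> : F = A by rewrite ltnNge leqnSn.
  rewrite FE; apply/seteqP; split=> y /= => [[]//|Ay]; split=> //.
  by apply: contrapT => ne; apply: (h y).
(* A codimension of at least two leaves a direction outside the span of F and [y1]. The functional
   [w] that turns the hyperplane takes the same value on F and at [y1], so [y1] stays off the
   hyperplane and the new face is proper. *)
have [y2 [Ay2 My2]] : exists y, A y /\ ~~ (y - x <= col_mx M (y1 - x))%MS.
  apply: contrapT => /forallNP h; move: dFA; rewrite ltnNge => /negP; apply.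
  have Ax0 : A !=set0 by exists x.
  apply: leq_trans (dim_le_rank (x := x) (B := col_mx M (y1 - x)) Ax0 _) _.
    by move=> y Ay; apply/negPn/negP => hy; apply: (h y).
  by apply: leq_trans (rank_leq_row _) _; rewrite addn1.
have [w [Mw wy2]] := submx_sep My2.
have Mw0 : M *m w = 0.
  by apply/matrixP => i j; move/matrixP: Mw => /(_ (lshift 1 i) j);
    rewrite mul_col_mx col_mxEu !mxE.
have y1w : dotp (y1 - x) w = 0.
  by move/matrixP: Mw => /(_ (rshift _ 0) 0);
    rewrite mul_col_mx col_mxEd /dotp [RHS]mxE.
have Fw y : F y -> dotp y w = dotp x w.
  move=> /spanM/submxP[D e]; apply/eqP; rewrite -subr_eq0 -dotpB e.
  by rewrite /dotp -mulmxA Mw0 mulmx0 mxE.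
pose wv i := dotp (row i V) w - dotp x w.
pose uv i := c - dotp (row i V) u.
have uv0 i : 0 <= uv i by rewrite subr_ge0 uc.
have [i0 wi0] : exists i, 0 < wv i.
  apply: contrapT => /forallNP h.
  have : dotp y2 w <= dotp x w.
    move: Ay2; rewrite AE; apply: dotp_conv_le => i.
    by have /negP := h i; rewrite -leNgt subr_le0.
  by move: wy2; rewrite dotpB; lra.
have uvF i : 0 < wv i -> 0 < uv i.
  move=> wi; rewrite lt_neqAle uv0 andbT eq_sym subr_eq0; apply/eqP => e.
  by move: wi; rewrite /wv Fw ?subrr ?ltxx // FE; split.
(* The smallest ratio belongs to the first generator that the turning hyperplane meets. *)
have [i wi imin] := @arg_minP _ _ _ i0 (fun i => 0 < wv i) (fun i =>
  uv i / wv i) wi0.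
pose t := uv i / wv i.
have t0 : 0 < t by rewrite divr_gt0 ?uvF.
pose u' := u + t *: w; pose c' := c + t * dotp x w.
have le' y : A y -> dotp y u' <= c'.
  rewrite AE; apply: dotp_conv_le => j; rewrite dotpDr dotpZr.
  suff : t * wv j <= uv j by rewrite /wv /uv /c'; lra.
  case: (ltP 0 (wv j)) => wj; first by rewrite -ler_pdivlMr // imin.
  by apply: le_trans (uv0 j); rewrite pmulr_rle0.
pose F' := [set y | A y /\ dotp y u' = c'].
have FF' : F `<=` F'.
  move=> y Fy; split; first exact: (faces_sub FA).
  by rewrite dotpDr dotpZr Fw // /c'; move: Fy; rewrite FE => -[_ ->].
have F'A : faces A F'.
  by split; [exists x; apply: FF' | exists u', c'].
exists F'; split=> //.
  move=> E; move: Ay1; rewrite -E => -[_]; rewrite dotpDr dotpZr /c'.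
  by move: y1w; rewrite dotpB => /eqP; rewrite subr_eq0 => /eqP -> /addIr /uy1.
apply: face_dim_lt; first exact: sub_face F'A FA FF'.
move=> E; have Fi : F' (row i V).
  split=> //; rewrite dotpDr dotpZr /c'.
  have : t * wv i = uv i by rewrite /t divfK // gt_eqF.
  by rewrite /wv /uv; lra.
have : F (row i V) by rewrite E.
by rewrite FE => -[_ e]; have := uvF i wi; rewrite /uv e subrr ltxx.
Qed.

Lemma facet_exists A : is_polytope A -> (0 < dim A)%N ->
  exists F, faces A F /\ (dim F).+1 = dim A.
Proof.
move=> Ap dA; have [F [FA nF]] := proper_face_exists Ap dA.
move: {2}(dim A - dim F)%N (leqnn (dim A - dim F)) => k.
elim: k F FA nF => [|k IH] F FA nF.
  by rewrite leqn0 subn_eq0 leqNgt face_dim_lt.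
move=> hk; have := face_dim_lt FA nF; rewrite leq_eqVlt => /predU1P[e|lt];
  first by exists F.
have [F' [F'A nF' lt']] := bigger_face Ap FA lt.
by apply: (IH F') => //; rewrite -ltnS (leq_trans _ hk) // ltn_sub2l // ltnW.
Qed.

End Facets.

(** * Isomorphisms of face posets *)

Section FaceIso.
Variable R : realType.

(** Using a map on all sets, constrained on faces only, lets the same map be restricted to a face,
    with no transport between subtypes. Injectivity on faces follows from the order condition. *)
Definition face_iso d d' (A : set 'rV[R]_d) (A' : set 'rV[R]_d')
    (g : set 'rV[R]_d -> set 'rV[R]_d') : Prop :=
  [/\ forall F, faces A F -> faces A' (g F),
      forall F G, faces A F -> faces A G -> (F `<=` G <-> g F `<=` g G) &
      forall G, faces A' G -> exists2 F, faces A F & g F = G].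

Lemma face_iso_restr d d' (A : set 'rV[R]_d) (A' : set 'rV[R]_d') g F :
  is_polytope A -> is_polytope A' ->
  face_iso A A' g -> faces A F -> face_iso F (g F) g.
Proof.
move=> Ap A'p [g1 g2 g3] FA.
have tr G : faces F G -> faces A G by apply: face_trans.
have tr' G : faces (g F) G -> faces A' G by apply: face_trans => //; apply: g1.
split.
- move=> G GF; apply: (sub_face (g1 _ FA) (g1 _ (tr _ GF))).
  by apply/g2 => //; [apply: tr | exact: faces_sub GF].
- by move=> G H /tr GA /tr HA; apply: g2.
- move=> G' G'F; have [G GA e] := g3 _ (tr' _ G'F); exists G => //.
  apply: (sub_face FA GA); apply/g2 => //; rewrite e; exact: faces_sub G'F.
Qed.

(** Induction through a facet of A: its image is a proper face of A', hence of smaller dimension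
    than A'. *)
Lemma face_iso_dim_le d d' (A : set 'rV[R]_d) (A' : set 'rV[R]_d') g :
  is_polytope A -> is_polytope A' -> face_iso A A' g -> (dim A <= dim A')%N.
Proof.
move: {2}(dim A) (erefl (dim A)) => n;
  elim: n A A' => [|n IH] A A' dA Ap A'p gi.
  by rewrite dA.
have [|F [FA dF]] := facet_exists Ap; first by rewrite dA.
have [g1 g2 g3] := gi; have FA' := g1 _ FA.
have dFn : dim F = n by move: dF; rewrite dA => -[].
have := IH F (g F) dFn (face_polytope Ap FA) (face_polytope A'p FA')
  (face_iso_restr Ap A'p gi FA).
rewrite -dF => /leq_ltn_trans; apply; apply: face_dim_lt => // E.
have A0 := is_polytope_nonempty Ap; have AA := faces_self A0.
have : A `<=` F by apply/g2 => //; rewrite E; apply: (faces_sub (g1 _ AA)).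
move=> AF; have e : F = A by apply/seteqP; split=> //; apply: faces_sub FA.
by move: dF; rewrite e => /eqP; rewrite gtn_eqF.
Qed.

Lemma comb_equivP (Q Q' : polytope R) :
  comb_equiv Q Q' <-> exists g, face_iso Q Q' g.
Proof.
split=> [[f [bf fS]]|[g [g1 g2 g3]]].
  have bfi := bij_inj bf.
  pose g F := if pselect (faces Q F) is left h then val (f (SigSub (mem_set
    h))) else setT.
  have gE (F : faces Q) : g (val F) = val (f F).
    rewrite /g; case: pselect => [h|]; last by case; apply: set_mem (valP F).
    by congr (val (f _)); apply: val_inj.
  have lift F (h : faces Q F) : F = val (SigSub (mem_set h) : faces Q) by [].
  exists g; split.
  - by move=> F h; rewrite (lift F h) gE; apply: set_mem (valP _).
  - by move=> F G h h'; rewrite (lift F h) (lift G h') !gE; apply: fS.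
  - move=> G h; have [f' fK f'K] := bf.
    exists (val (f' (SigSub (mem_set h)))); first exact: set_mem (valP _).
    by rewrite gE f'K.
have h1 (F : faces Q) : g (val F) \in faces Q' by
  apply/mem_set/g1/set_mem/(valP F).
pose f (F : faces Q) : faces Q' := SigSub (h1 F).
exists f; split; last first.
  by move=> F G; rewrite /f /=; apply: g2;
    [apply: set_mem (valP F)|apply: set_mem (valP G)].
have [f' f'P] : {f' : faces Q' -> faces Q & forall G, g (val (f' G)) = val G}.
  apply: (@choice _ _ (fun G F => g (val F) = val G)) => G.
  have [F h e] := g3 _ (set_mem (valP G)).
  by exists (SigSub (mem_set h)).
exists f' => [F|G]; last by apply: val_inj; rewrite /= f'P.
apply: val_inj; have := f'P (f F); rewrite /= => e.
have FF := set_mem (valP F); have FF' := set_mem (valP (f' (f F))).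
by apply/seteqP; split; apply/g2 => //; rewrite e.
Qed.

Lemma comb_equiv_dim (Q Q' : polytope R) : comb_equiv Q Q' -> dim Q = dim Q'.
Proof.
move=> h; have h' : comb_equiv Q' Q.
  by apply: asboolW; move/asboolT: h;
    rewrite -!/(comb_equivb _ _) comb_equivb_sym.
move: h h' => /comb_equivP[g gi] /comb_equivP[g' gi'].
by apply/eqP; rewrite eqn_leq (face_iso_dim_le _ _ gi) ?(face_iso_dim_le _ _
  gi') //; apply: polytopeP.
Qed.

End FaceIso.

(** * Classes of polytopes in the ring *)

Section ClassGroup.
Variable R : realType.
Local Notation PG := (polytope_group R).

(** The default value 0 off the polytopes keeps proofs out of the summands when faces are summed. *)
Definition cls d (A : set 'rV[R]_d) : PG :=
  if pselect (is_polytope A) is left Ap then generator (Polytope Ap) else 0.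

Lemma clsE d (A : set 'rV[R]_d) (Ap : is_polytope A) :
  cls A = generator (Polytope Ap).
Proof.
rewrite /cls; case: pselect => // Ap'.
by rewrite (Prop_irrelevance Ap Ap').
Qed.

Lemma cls_polytope (Q : polytope R) : cls Q = generator Q.
Proof. by rewrite (clsE (polytopeP Q)) polytope_eta. Qed.

Lemma generator_eq (Q Q' : polytope R) : comb_equiv Q Q' ->
  generator Q = generator Q'.
Proof.
move=> h; rewrite /generator; congr << _ >>; apply/eqmodP; exact/asboolP.
Qed.

Lemma cls_eq d d' (A : set 'rV[R]_d) (A' : set 'rV[R]_d') g :
  is_polytope A -> is_polytope A' -> face_iso A A' g -> cls A = cls A'.
Proof.
move=> Ap A'p gi; rewrite (clsE Ap) (clsE A'p); apply: generator_eq.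
by apply/comb_equivP; exists g.
Qed.

Lemma repr_equiv (Q : polytope R) : comb_equiv (repr (comb_class Q)) Q.
Proof.
have /eqmodP : (\pi_(comb_polytope R) (repr (comb_class Q)) =
  \pi_(comb_polytope R) Q)%qT by rewrite reprK.
exact: asboolW.
Qed.

Lemma class_dimE (Q : polytope R) : class_dim (comb_class Q) = dim Q.
Proof. exact/comb_equiv_dim/repr_equiv. Qed.

Lemma xi_cls d (A : set 'rV[R]_d) : is_polytope A -> xi (cls A) = 'X^(dim A).
Proof. by move=> Ap; rewrite (clsE Ap) /xi liftU scale1r class_dimE. Qed.

Lemma finite_codim_faces d (A : set 'rV[R]_d) (P : set (set 'rV[R]_d)) :
  is_polytope A -> finite_set [set F | faces A F /\ P F].
Proof. by move=> /finite_faces; apply: sub_finite_set => F []. Qed.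

(** The operator is defined through a chosen representative; an isomorphism from it to A restricts
    to faces, so it preserves their dimensions and classes. *)
Lemma face_op_cls k d (A : set 'rV[R]_d) : is_polytope A ->
  face_op R k (cls A) =
  \sum_(F \in [set F | faces A F /\ (dim F + k)%N = dim A]) cls F.
Proof.
move=> Ap; rewrite (clsE Ap) /face_op /= /face_op_fun liftU scale1r
  /class_face_sum.
set x := comb_class _; have xA := repr_equiv (Polytope Ap).
rewrite -/x in xA; have [g gi] := proj1 (comb_equivP _ _) xA.
have [g1 g2 g3] := gi; rewrite /= in g1 g2 g3 gi.
have xp := polytopeP (repr x).
rewrite class_dimE /=.
have dimg F : faces (repr x) F -> dim (g F) = dim F.
  move=> FX; have Fp := face_polytope xp FX;
    have gFp := face_polytope Ap (g1 _ FX).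
  apply/esym; apply: (@comb_equiv_dim _ (Polytope Fp) (Polytope gFp)).
  by apply/comb_equivP; exists g; exact: (face_iso_restr xp Ap gi FX).
have vF (F : faces (repr x)) := set_mem (valP F).
rewrite [RHS](reindex_fsbig (fun F : faces (repr x) => g (val F))
  [set F | (dim (val F) + k)%N = dim A]).
  apply: eq_fsbigr => F _; rewrite -cls_polytope /=.
  exact: (cls_eq (face_polytope xp (vF F)) (face_polytope Ap (g1 _ (vF F)))
    (face_iso_restr xp Ap gi (vF F))).
split.
- by move=> F /= e; split; [exact: g1 (vF F) | rewrite (dimg _ (vF F))].
- move=> F G _ _ e; apply: val_inj; apply/seteqP.
  by split; apply/(g2 _ _ (vF _) (vF _)); rewrite e.
- move=> G [/g3[F FX e] dG]; exists (SigSub (mem_set FX)) => //=.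
  by rewrite -dimg // e.
Qed.

Lemma polytope_group_ind (P : PG -> Prop) :
  P 0 -> (forall p q, P p -> P q -> P (p - q)) ->
  (forall d (A : set 'rV[R]_d), is_polytope A -> P (cls A)) -> forall p, P p.
Proof.
move=> P0 PB PA p.
have PN q : P q -> P (- q) by move=> Pq; rewrite -sub0r; apply: PB.
have PD q q' : P q -> P q' -> P (q + q').
  by move=> Pq Pq'; rewrite -[q']opprK; apply/PB/PN.
rewrite -(freeg_sumE p).
apply: (big_ind P) => // x _.
have Px : P << x >>.
  have -> : << x >> = generator (repr x) :> PG by rewrite /generator
    /comb_class reprK.
  by rewrite -cls_polytope; apply: PA; apply: polytopeP.
rewrite (_ : << _ *g x >> = << x >> *~ coeff x p :> PG);
  last by rewrite freegU_mulz intz.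
have Pn n : P (<< x >> *+ n : PG).
  by elim: n => [|n IH]; rewrite ?mulr0n // mulrS; apply: PD.
by case: (coeff x p) => n; [exact: Pn | exact: PN (Pn n.+1)].
Qed.

Lemma subgroup_gen_ind (U : zmodType) (G : set U) (P : U -> Prop) :
  P 0 -> (forall p q, P p -> P q -> P (p - q)) -> (forall p, G p -> P p) ->
  forall p, subgroup_gen G p -> P p.
Proof.
move=> P0 PB PG p; apply; split=> //; split; first exact/mem_set.
by move=> x y /set_mem Px /set_mem Py; apply/mem_set/PB.
Qed.

Lemma subgroup_gen_closed (U : zmodType) (G : set U) :
  [/\ G `<=` subgroup_gen G, subgroup_gen G 0,
      forall p q, subgroup_gen G p -> subgroup_gen G q ->
        subgroup_gen G (p - q) &
      forall p q, subgroup_gen G p -> subgroup_gen G q ->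
        subgroup_gen G (p + q)].
Proof.
have h0 : subgroup_gen G 0 by move=> S [[S0 _] _]; apply: set_mem.
have hB p q : subgroup_gen G p -> subgroup_gen G q -> subgroup_gen G (p - q).
  move=> hp hq S GS; have [[_ SB] _] := GS.
  by apply/set_mem/SB; apply/mem_set; [apply: hp | apply: hq].
split=> // [p Gp S [_ GS]|p q hp hq]; first exact: GS.
by rewrite -[q]opprK; apply: (hB) => //; rewrite -sub0r; apply: hB.
Qed.

Lemma additive_ext (U : zmodType) (f g : PG -> U) :
  zmod_morphism f -> zmod_morphism g ->
  (forall d (A : set 'rV[R]_d), is_polytope A -> f (cls A) = g (cls A)) ->
    f =1 g.
Proof.
move=> fB gB h; apply: polytope_group_ind => //.
  by rewrite -(subrr (0 : PG)) fB gB !subrr.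
by move=> p q e e'; rewrite fB gB e e'.
Qed.

End ClassGroup.

(** * Pyramids and bipyramids *)

Section ConeOver.
Variable R : realType.

Section Ambient.
Variable d : nat.
Implicit Types (A F G X : set 'rV[R]_d) (x y p q : 'rV[R]_d) (u w : 'cV[R]_d).

(** The apex is put in separately so that the join with the empty set is [[set p]]: the apex is then
    the cone over the empty face. *)
Definition cjoin F p : set 'rV[R]_d :=
  [set y | y = p \/ exists x t, [/\ F x, 0 <= t <= 1 & y =
    (1 - t) *: x + t *: p]].

(** The point lies off the affine hull of F. The witness [w] is what later proofs add to a
    supporting functional to adjust its value at p alone. *)
Definition apart F p : Prop :=
  exists w c, (forall x, F x -> dotp x w = c) /\ dotp p w <> c.

Lemma cjoin_apex F p : cjoin F p p.
Proof. by left. Qed.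

Lemma cjoin_base F p : F `<=` cjoin F p.
Proof.
move=> x Fx; right; exists x, 0; split=> //; first by rewrite lexx ler01.
by rewrite subr0 scale1r scale0r addr0.
Qed.

Lemma cjoinS F G p : F `<=` G -> cjoin F p `<=` cjoin G p.
Proof. by move=> FG y [->|[x [t [/FG Gx ht ->]]]]; [left | right;
  exists x, t]. Qed.

Lemma cjoin0 p : cjoin set0 p = [set p].
Proof.
apply/seteqP; split=> y; last by move=> ->; left.
by case=> [->//|[x [t []]]].
Qed.

Lemma apartS F A p : F `<=` A -> apart A p -> apart F p.
Proof. by move=> FA [w [c [h hp]]]; exists w, c; split=> // x /FA /h. Qed.

Lemma cjoin_polytope A p : is_polytope A -> is_polytope (cjoin A p).
Proof.
move=> Ap; have [[x0 Ax0] [m [V AE]]] := Ap; split; first by exists p; left.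
exists (m + 1)%N, (col_mx V p); apply/seteqP; split=> y.
  have Dp : conv (col_mx V p) p.
    by have := row_conv (col_mx V p) (rshift m 0); rewrite rowKd row_id.
  case=> [->//|[x [t [Ax ht ->]]]]; apply: conv_convex => //.
  move: Ax; rewrite AE => -[a [a0 a1 ->]]; exists (row_mx a 0); split.
  - by move=> i; case: (split_ordP i) => j ->;
      rewrite ?row_mxEl // row_mxEr mxE.
  - rewrite big_split_ord /= [X in _ + X]big1 => [|i _];
      last by rewrite row_mxEr mxE.
    by rewrite addr0 -[RHS]a1; apply: eq_bigr => i _; rewrite row_mxEl.
  - by rewrite mul_row_col mul0mx addr0.
case=> a [a0 a1 ->]; rewrite -[a]hsubmxK mul_row_col.
set b := lsubmx a; set t := rsubmx a 0 0.
have b0 i : 0 <= b 0 i by rewrite mxE.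
have t0 : 0 <= t by rewrite /t mxE.
have bt : \sum_i b 0 i = 1 - t.
  rewrite -a1 big_split_ord /= big_ord1 /t mxE addrK.
  by apply: eq_bigr => i _; rewrite mxE.
rewrite [rsubmx a]mx11_scalar mul_scalar_mx -/t.
have [t1|t1] := eqVneq t 1.
  left; suff -> : b = 0 by rewrite mul0mx add0r t1 scale1r.
  move: bt; rewrite t1 subrr => /eqP; rewrite psumr_eq0 // => /allP h.
  by apply/rowP => i; rewrite [RHS]mxE; apply/eqP/(h i)/mem_index_enum.
have t1' : 0 < 1 - t.
  rewrite lt_neqAle eq_sym subr_eq0 eq_sym t1 /= -bt.
  by apply: sumr_ge0.
right; exists ((1 - t)^-1 *: b *m V), t; split.
- rewrite AE; exists ((1 - t)^-1 *: b); split=> //.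
    by move=> i; rewrite mxE mulr_ge0 // invr_ge0 ltW.
  under eq_bigr do rewrite mxE.
  by rewrite -mulr_sumr bt mulVf // gt_eqF.
- by rewrite t0 -subr_ge0 ltW.
- by rewrite -scalemxAl scalerA mulfV ?scale1r // gt_eqF.
Qed.

Lemma dotp_cjoin_le A p u c : (forall x, A x -> dotp x u <= c) ->
  dotp p u <= c -> forall y, cjoin A p y -> dotp y u <= c.
Proof.
move=> Ac pc y [->//|[x [t [/Ac xc /andP[t0 t1] ->]]]].
rewrite dotpD !dotpZ.
have h1 : (1 - t) * dotp x u <= (1 - t) * c by rewrite ler_wpM2l // subr_ge0.
have h2 : t * dotp p u <= t * c by rewrite ler_wpM2l.
by move: h1 h2; lra.
Qed.

(** In a convex combination of values at most c, equality with c forces it for every term of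
    positive weight. *)
Lemma cjoin_expose A p u c : (forall x, A x -> dotp x u <= c) ->
  dotp p u <= c ->
  [set y | cjoin A p y /\ dotp y u = c] =
  let F := [set x | A x /\ dotp x u = c] in
  if dotp p u == c then cjoin F p else F.
Proof.
move=> Ac pc /=; set F := [set x | _]; apply/seteqP; split=> y /=.
  case: eqP => [pe|pne] [[->|[x [t [Ax /andP[t0 t1] ->]]]] e] //.
  - by left.
  - have [t1'|t1'] := eqVneq t 1.
      by left; rewrite t1' subrr scale0r add0r scale1r.
    right; exists x, t; split; rewrite ?t0 //; split=> //.
    move: e; rewrite dotpD !dotpZ pe => e.
    have nz : 1 - t != 0 by rewrite subr_eq0 eq_sym.
    by apply: (mulfI nz); lra.
  - have pc' : dotp p u < c by rewrite lt_neqAle pc andbT; apply/eqP.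
    have t0' : t = 0.
      apply/eqP/negPn/negP => tn0;
        have tp : 0 < t by rewrite lt_neqAle eq_sym tn0.
      have h1 : (1 - t) * dotp x u <= (1 - t) * c by rewrite ler_wpM2l
        ?subr_ge0 ?(Ac x Ax).
      have h2 : t * dotp p u < t * c by rewrite ltr_pM2l.
      by move: e; rewrite dotpD !dotpZ; lra.
    by move: e; rewrite t0' subr0 scale1r scale0r addr0.
case: eqP => [pe|pne]; last by move=> [Ay e]; split=> //; apply: cjoin_base.
case=> [->|[x [t [[Ax e] ht ->]]]]; first by split=> //; left.
split; first by right; exists x, t.
by rewrite dotpD !dotpZ pe e; lra.
Qed.

Lemma cjoinIbase A F p : apart A p -> F `<=` A -> cjoin F p `&` A = F.
Proof.
move=> [w [c [Aw pw]]] FA; apply/seteqP; split=> y; last first.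
  by move=> Fy; split; [apply: cjoin_base | apply: FA].
case=> [[->|[x [t [Fx ht ->]]]] Ay]; first by case: pw; apply: Aw.
have := Aw _ Ay; rewrite dotpD !dotpZ (Aw x (FA x Fx)) => e.
suff -> : t = 0 by rewrite subr0 scale1r scale0r addr0.
have nz : dotp p w - c != 0 by rewrite subr_eq0; apply/eqP.
by apply: (mulIf nz); move: e; lra.
Qed.

Lemma apart_notin A p : apart A p -> ~ A p.
Proof. by move=> [w [c [Aw pw]]] /Aw. Qed.

Lemma cjoin_inj A F G p : apart A p -> F `<=` A -> G `<=` A ->
  cjoin F p = cjoin G p -> F = G.
Proof. by move=> ap FA GA e; rewrite -(cjoinIbase ap FA) e cjoinIbase. Qed.

(* Adding a multiple of a functional constant on A changes its value at p
  freely. *)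
Lemma cjoin_faces_base A F p : apart A p -> faces A F -> faces (cjoin A p) F.
Proof.
move=> [w [e [Aw pw]]] [F0 [u [c [uc FE]]]]; split=> //.
have nz : dotp p w - e != 0 by rewrite subr_eq0; apply/eqP.
pose s := (c - dotp p u - 1) / (dotp p w - e).
have sE : s * (dotp p w - e) = c - dotp p u - 1 by rewrite divfK.
have uA x : A x -> dotp x (u + s *: w) = dotp x u + s * e.
  by move=> Ax; rewrite dotpDr dotpZr Aw.
have up : dotp p (u + s *: w) < c + s * e.
  by rewrite dotpDr dotpZr; move: sE; lra.
exists (u + s *: w), (c + s * e).
have le x : A x -> dotp x (u + s *: w) <= c + s * e.
  by move=> Ax; rewrite uA // lerD2r uc.
split; first by apply: dotp_cjoin_le => //; apply: ltW.
rewrite cjoin_expose ?(ltW up) //= (lt_eqF up) FE; apply/seteqP.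
by split=> x /= -[Ax]; rewrite uA // => h; split=> //; move: h;
  [move=> -> | move/addIr].
Qed.

Lemma cjoin_faces_cone A F p : apart A p -> faces A F ->
  faces (cjoin A p) (cjoin F p).
Proof.
move=> [w [e [Aw pw]]] [F0 [u [c [uc FE]]]]; split; first by exists p; left.
have nz : dotp p w - e != 0 by rewrite subr_eq0; apply/eqP.
(* This multiple of [w] brings the value at p exactly to the maximum, so that p joins the exposed
   face. *)
pose s := (c - dotp p u) / (dotp p w - e).
have sE : s * (dotp p w - e) = c - dotp p u by rewrite divfK.
have uA x : A x -> dotp x (u + s *: w) = dotp x u + s * e.
  by move=> Ax; rewrite dotpDr dotpZr Aw.
have up : dotp p (u + s *: w) = c + s * e.
  by rewrite dotpDr dotpZr; move: sE; lra.
exists (u + s *: w), (c + s * e).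
have le x : A x -> dotp x (u + s *: w) <= c + s * e.
  by move=> Ax; rewrite uA // lerD2r uc.
split; first by apply: dotp_cjoin_le => //; rewrite up.
rewrite cjoin_expose ?up //= eqxx FE; congr (cjoin _ p); apply/seteqP.
by split=> x /= -[Ax]; rewrite uA // => h; split=> //; move: h;
  [move=> -> | move/addIr].
Qed.

Lemma cjoin_faces_apex A p : apart A p -> faces (cjoin A p) [set p].
Proof.
move=> [w [e [Aw pw]]]; split; first by exists p.
have nz : dotp p w - e != 0 by rewrite subr_eq0; apply/eqP.
pose s := (dotp p w - e)^-1.
have sE : s * (dotp p w - e) = 1 by rewrite mulVf.
have uA x : A x -> dotp x (s *: w) < dotp p (s *: w).
  by move=> Ax; rewrite !dotpZr Aw //; move: sE; lra.
exists (s *: w), (dotp p (s *: w)).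
have le x : A x -> dotp x (s *: w) <= dotp p (s *: w) by move=> /uA/ltW.
split; first exact: dotp_cjoin_le.
rewrite cjoin_expose //= eqxx -cjoin0; congr (cjoin _ p); apply/seteqP.
by split=> x // -[/uA]; rewrite lt_neqAle => /andP[/eqP].
Qed.

Lemma cjoin_facesP A p X : faces (cjoin A p) X ->
  [\/ X = [set p], faces A X | exists2 F, faces A F & X = cjoin F p].
Proof.
move=> [X0 [u [c [uc XE]]]].
have uA x : A x -> dotp x u <= c by move=> Ax; apply/uc/cjoin_base.
have up : dotp p u <= c by apply/uc/cjoin_apex.
pose F := [set x | A x /\ dotp x u = c].
have FA : F !=set0 -> faces A F by move=> F0; split=> //; exists u, c.
move: XE; rewrite cjoin_expose //= -/F; case: ifP => _ XE.
  have [F0|Fn0] := pselect (F = set0).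
    by constructor 1; rewrite XE F0 cjoin0.
  constructor 3; exists F => //.
  by apply: FA; apply/set0P/eqP.
by constructor 2; rewrite XE; apply: FA; rewrite -XE.
Qed.

Lemma dim_cjoin_le A p : is_polytope A -> (dim (cjoin A p) <= (dim A).+1)%N.
Proof.
move=> [A0 _]; have [x [M [Ax _ fM sM]]] := dim_basis A0.
apply: (@leq_trans (\rank (col_mx M (p - x)))).
  apply: (dim_le_rank (x := x)); first by exists p; left.
  move=> y [->|[z [t [Az _ ->]]]]; first by rewrite -addsmxE addsmxSr.
  have -> : (1 - t) *: z + t *: p - x = (1 - t) *: (z - x) + t *: (p - x).
    by rewrite !scalerBr addrACA -opprD -scalerDl subrK scale1r.
  rewrite -addsmxE; apply: addmx_sub; apply: scalemx_sub.
    by apply: submx_trans (addsmxSl _ _); apply: sM.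
  exact: addsmxSr.
by apply: leq_trans (rank_leq_row _) _; rewrite addn1.
Qed.

Lemma dim_cjoin A p : is_polytope A -> apart A p ->
  dim (cjoin A p) = (dim A).+1.
Proof.
move=> Ap ap; apply/eqP; rewrite eqn_leq dim_cjoin_le //=.
apply: face_dim_lt; first
  exact/cjoin_faces_base/faces_self/is_polytope_nonempty.
by move=> E; apply: (apart_notin ap); rewrite E; left.
Qed.

End Ambient.

Lemma cjoin_iso d d' (A : set 'rV[R]_d) (A' : set 'rV[R]_d') p p' g :
  is_polytope A -> is_polytope A' -> apart A p -> apart A' p' ->
  face_iso A A' g -> exists g', face_iso (cjoin A p) (cjoin A' p') g'.
Proof.
move=> Ap A'p ap ap' [g1 g2 g3].
have pA := apart_notin ap; have pA' := apart_notin ap'.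
(* A face of the pyramid is determined by its trace on the base, possibly empty, and by whether it
   contains the apex; [h] extends [g] to the empty trace. *)
pose h F := if pselect (F = set0) then set0 else g F.
have hF F : faces A F -> h F = g F.
  by rewrite /h; case: pselect => // F0 /faces_nonempty /set0P/negP; case;
    apply/eqP.
have h0 : h set0 = set0 by rewrite /h; case: pselect.
pose g' X := if pselect (X p) then cjoin (h (X `&` A)) p' else h (X `&` A).
have gb F : faces A F -> g' F = g F.
  move=> FA; rewrite /g'; case: pselect => [Fp|np]; first by case: pA;
    apply: (faces_sub FA).
  by rewrite setIidl ?hF //; apply: faces_sub.
have gc F : faces A F -> g' (cjoin F p) = cjoin (g F) p'.
  move=> FA; rewrite /g'; case: pselect => [pp|[]]; last by left.
  by rewrite cjoinIbase ?hF //; apply: faces_sub.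
have ga : g' [set p] = [set p'].
  rewrite /g'; case: pselect => [pp|[]] //=.
  by rewrite -[in h _]cjoin0 cjoinIbase // h0 !cjoin0.
have sc F G : faces A F -> faces A G -> F `<=` cjoin G p <-> F `<=` G.
  move=> FA GA; split=> [FG x Fx|FG];
    last exact: subset_trans FG (@cjoin_base _ G p).
  rewrite -(cjoinIbase ap (faces_sub GA)); split;
    [exact: FG|exact: faces_sub Fx].
have sc' F G : faces A' F -> faces A' G -> F `<=` cjoin G p' <-> F `<=` G.
  move=> FA GA; split=> [FG x Fx|FG];
    last exact: subset_trans FG (@cjoin_base _ G p').
  rewrite -(cjoinIbase ap' (faces_sub GA)); split;
    [exact: FG|exact: faces_sub Fx].
have cc F G : faces A F -> faces A G -> cjoin F p `<=` cjoin G p <-> F `<=` G.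
  move=> FA GA; split; last exact: cjoinS.
  by move=> FG; apply/sc => //; apply: subset_trans FG; apply: cjoin_base.
have cc' F G : faces A' F -> faces A' G ->
  cjoin F p' `<=` cjoin G p' <-> F `<=` G.
  move=> FA GA; split; last exact: cjoinS.
  by move=> FG; apply/sc' => //; apply: subset_trans FG; apply: cjoin_base.
have ap_sub d1 (F : set 'rV[R]_d1) q : [set q] `<=` cjoin F q.
  by move=> _ ->; left.
have nsub d1 (A1 F : set 'rV[R]_d1) q X : ~ A1 q -> faces A1 F -> X q ->
  ~ X `<=` F.
  by move=> nq FA Xq XF; apply/nq/(faces_sub FA)/XF.
have nap d1 (A1 F X : set 'rV[R]_d1) q : ~ A1 q -> faces A1 F ->
  F `<=` X -> ~ X `<=` [set q].
  move=> nq FA FX Xq; have [x Fx] := faces_nonempty FA; apply: nq.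
  by have := Xq x (FX x Fx) => /= <-; apply: faces_sub Fx.
exists g'; split.
- move=> X /cjoin_facesP[->|FA|[F FA ->]].
  + by rewrite ga; apply: cjoin_faces_apex.
  + by rewrite gb //; apply: cjoin_faces_base => //; apply: g1.
  + by rewrite gc //; apply: cjoin_faces_cone => //; apply: g1.
- move=> X Y /cjoin_facesP[->|FA|[F FA ->]] /cjoin_facesP[->|GA|[G GA ->]];
    rewrite ?ga.
  + by split=> _ y ->.
  + rewrite (gb _ GA); have GA' := g1 _ GA.
    by split=> h'; [case: (nsub _ _ _ _ _ pA GA _ h')|case: (nsub _ _ _ _ _
      pA' GA' _ h')].
  + by rewrite (gc _ GA); split=> _; apply: ap_sub.
  + rewrite (gb _ FA); have FA' := g1 _ FA.
    by split=> h'; [case: (nap _ _ _ _ _ pA FA _ h')|case: (nap _ _ _ _ _ pA'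
      FA' _ h')].
  + by rewrite !gb //; apply: g2.
  + by rewrite gb // gc // sc // sc' ?g2 //; apply: g1.
  + rewrite (gc _ FA); have FA' := g1 _ FA.
    split=> h'; [case: (nap _ _ _ _ _ pA FA _ h')|case: (nap _ _ _ _ _ pA'
      FA' _ h')];
      exact: cjoin_base.
  + rewrite (gc _ FA) (gb _ GA); have GA' := g1 _ GA.
    split=> h'; [case: (nsub _ _ _ _ _ pA GA _ h')|case: (nsub _ _ _ _ _ pA'
      GA' _ h')];
      exact: cjoin_apex.
  + by rewrite !gc // cc // cc' ?g2 //; apply: g1.
- move=> X /cjoin_facesP[->|/g3[F FA e]|[G /g3[F FA e] ->]].
  + by exists [set p] => //; apply: cjoin_faces_apex.
  + by exists F; rewrite ?gb //; apply: cjoin_faces_base.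
  + by exists (cjoin F p); rewrite ?gc ?e //; apply: cjoin_faces_cone.
Qed.

End ConeOver.

(** * The pyramid as an operator on the ring *)

Section ConeOperator.
Variable R : realType.
Local Notation PG := (polytope_group R).

(** The additional coordinate makes room for an apex when A is full-dimensional. *)
Definition emb d (A : set 'rV[R]_d) : set 'rV[R]_(d + 1) :=
  [set row_mx x (0 : 'rV_1) | x in A].

Lemma dotp_row_mx d e (x : 'rV[R]_d) (y : 'rV[R]_e) u v :
  dotp (row_mx x y) (col_mx u v) = dotp x u + dotp y v.
Proof. by rewrite /dotp mul_row_col mxE. Qed.

Lemma dotp_emb d (x : 'rV[R]_d) (u : 'cV[R]_(d + 1)) :
  dotp (row_mx x (0 : 'rV_1)) u = dotp x (usubmx u).
Proof. by rewrite -[u in LHS]vsubmxK dotp_row_mx [dotp 0 _]/dotp mul0mx mxE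
  addr0. Qed.

Lemma emb_polytope d (A : set 'rV[R]_d) : is_polytope A -> is_polytope (emb A).
Proof.
move=> [[x Ax] [m [V AE]]]; split; first by exists (row_mx x 0); exists x.
exists m, (row_mx V 0); rewrite AE; apply/seteqP; split=> y.
  by case=> _ [a [a0 a1 ->] <-]; exists a; rewrite mul_mx_row mulmx0.
by case=> a [a0 a1 ->]; exists (a *m V); [exists a | rewrite mul_mx_row mulmx0].
Qed.

Lemma emb_iso d (A : set 'rV[R]_d) : face_iso A (emb A) (@emb d).
Proof.
split.
- move=> F [[x Fx] [u [c [uc FE]]]]; split; first by exists (row_mx x 0);
    exists x.
  exists (col_mx u 0), c; split.
    by move=> _ [z Az <-]; rewrite dotp_emb col_mxKu uc.
  apply/seteqP; split=> y.
    by case=> z Fz <-; rewrite FE in Fz; case: Fz => Az e; split;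
      [exists z|rewrite dotp_emb col_mxKu].
  case=> [[z Az <-]]; rewrite dotp_emb col_mxKu => e; exists z => //;
    by rewrite FE.
- move=> F G _ _; split=> [FG _ [x Fx <-]|FG x Fx].
    by exists x => //; apply: FG.
  have [|y Gy] := FG (row_mx x 0); first by exists x.
  by move=> /eq_row_mx[<-].
- move=> G [[y Gy] [u [c [uc GE]]]].
  exists [set x | A x /\ dotp x (usubmx u) = c].
    split; last first.
      exists (usubmx u), c; split=> // x Ax; rewrite -dotp_emb; apply: uc;
        by exists x.
    by move: Gy; rewrite GE => -[[x Ax <-]]; rewrite dotp_emb; exists x.
  rewrite GE; apply/seteqP; split=> z.
    by case=> x [Ax e] <-; split; [exists x|rewrite dotp_emb].
  by case=> [[x Ax <-]]; rewrite dotp_emb => e; exists x.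
Qed.

Lemma emb_apart d (A : set 'rV[R]_d) x (t : R) : t != 0 ->
  apart (emb A) (row_mx x t%:M).
Proof.
move=> t0; exists (col_mx 0 1), 0; split.
  by move=> _ [y Ay <-]; rewrite dotp_emb col_mxKu /dotp mulmx0 mxE.
rewrite dotp_row_mx [dotp x 0]/dotp mulmx0 mxE add0r /dotp mulmx1 mxE mulr1n.
exact/eqP.
Qed.

Lemma cls_emb d (A : set 'rV[R]_d) : is_polytope A -> cls (emb A) = cls A.
Proof.
by move=> Ap; apply/esym/(cls_eq _ _ (emb_iso A)) => //; apply: emb_polytope.
Qed.

Lemma cls_iso d d' (A : set 'rV[R]_d) (A' : set 'rV[R]_d') :
  is_polytope A -> is_polytope A' -> cls A = cls A' ->
    exists g, face_iso A A' g.
Proof.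
move=> Ap A'p; rewrite (clsE Ap) (clsE A'p) /generator.
set x := comb_class _; set y := comb_class _ => /(congr1 (coeff y)).
rewrite !coeffU !mul1r eqxx;
  case: eqP => // /eqmodP/asboolW/comb_equivP[g] gi _.
by exists g.
Qed.

Definition cone_class (x : comb_polytope R) : PG :=
  cls (cjoin (emb (repr x)) (row_mx 0 1)).

Definition cone_op : PG -> PG := fglift cone_class.

Lemma cone_op_additive : zmod_morphism cone_op.
Proof. exact: lift_is_additive. Qed.

HB.instance Definition _ := GRing.isZmodMorphism.Build PG PG cone_op
  cone_op_additive.

(** By [cjoin_iso] the class of a pyramid depends neither on the representative of its base nor on
    the apex. *)
Lemma cone_op_cls d (A : set 'rV[R]_d) p : is_polytope A -> apart A p ->
  cone_op (cls A) = cls (cjoin A p).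
Proof.
move=> Ap ap; rewrite (clsE Ap) /cone_op liftU scale1r /cone_class.
set x := comb_class _; have xp := polytopeP (repr x).
have e : cls (emb (repr x)) = cls A.
  by rewrite cls_emb // cls_polytope (clsE Ap); apply/generator_eq/repr_equiv.
have [g gi] := cls_iso (emb_polytope xp) Ap e.
have ap' := emb_apart (repr x) (0 : 'rV_(ambient (repr x))) (oner_neq0 R).
have [g' gi'] := cjoin_iso (emb_polytope xp) Ap ap' ap gi.
by apply: (cls_eq _ _ gi'); apply: cjoin_polytope => //; apply: emb_polytope.
Qed.

Lemma point_polytope d (p : 'rV[R]_d) : is_polytope [set p].
Proof.
split; first by exists p.
exists 1%N, p; apply/seteqP; split=> y.
  by move=> ->; have := row_conv p 0; rewrite row_id.
case=> a [_]; rewrite big_ord1 => a1 ->.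
by rewrite [a]mx11_scalar a1 mul1mx.
Qed.

Lemma dim_point d (p : 'rV[R]_d) : dim [set p] = 0%N.
Proof.
apply/eqP; rewrite -leqn0 -[X in (_ <= X)%N](mxrank0 R 1 d).
by apply: (dim_le_rank (x := p)) => [|y ->]; [exists p | rewrite subrr sub0mx].
Qed.

Lemma point_faces d (p : 'rV[R]_d) F : faces [set p] F -> F = [set p].
Proof.
move=> FA; apply/seteqP; split=> x; first exact: faces_sub FA x.
by move=> ->; have [y Fy] := faces_nonempty FA;
  have := faces_sub FA Fy => /= <-.
Qed.

Lemma cls_point d d' (p : 'rV[R]_d) (p' : 'rV[R]_d') : cls [set p] =
  cls [set p'].
Proof.
apply: (cls_eq (g := fun=> [set p'])); try exact: point_polytope.
have self e (q : 'rV[R]_e) : faces [set q] [set q] by apply: faces_self;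
  exists q.
split=> // [F G /point_faces -> /point_faces ->|G /point_faces ->];
  first by split=> _ ? ->.
by exists [set p].
Qed.

Definition pt : PG := cls [set (0 : 'rV[R]_0)].

Lemma raddf_fsbig (U W : zmodType) (I : choiceType) (f : {additive U -> W})
  (S : set I) (g : I -> U) : finite_set S ->
  f (\sum_(i \in S) g i) = \sum_(i \in S) f (g i).
Proof. by move=> fS; rewrite !fsbig_finite // raddf_sum. Qed.

Lemma fsbig_point (U : zmodType) (I : choiceType) (i : I) (b : bool) (g : I
  -> U) :
  \sum_(j \in [set j | j = i /\ b]) g j = g i *+ b.
Proof.
case: b.
  rewrite (_ : [set j | _] = [set i]) ?fsbig_set1 ?mulr1n //.
  by apply/seteqP; split=> j [].
rewrite (_ : [set j | _] = set0) ?fsbig_set0 //.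
by apply/seteqP; split=> j [].
Qed.

Lemma cone_sum d (A : set 'rV[R]_d) p k : is_polytope A -> apart A p ->
  \sum_(X \in (@cjoin R d)^~ p @` [set F | faces A F /\ (dim F + k)%N =
    dim A]) cls X =
  cone_op (face_op R k (cls A)).
Proof.
move=> Ap ap; rewrite face_op_cls // raddf_fsbig;
  last exact: finite_codim_faces.
rewrite fsbig_image.
  apply: eq_fsbigr => F; rewrite inE /= => -[FA _].
  by rewrite (cone_op_cls (face_polytope Ap FA) (apartS (faces_sub FA) ap)).
move=> F G; rewrite !inE /= => -[FA _] [GA _].
by apply: (cjoin_inj ap); apply: faces_sub.
Qed.

(** Passing to the pyramid, the cone over a face keeps the codimension and a face of the base gains
    one. The point term is the apex, the cone over the empty face, of codimension [(dim A).+1]. *)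
Lemma face_op_cone d (A : set 'rV[R]_d) p k : is_polytope A -> apart A p ->
  face_op R k.+1 (cls (cjoin A p)) =
  cone_op (face_op R k.+1 (cls A)) + face_op R k (cls A) + pt *+ (k == dim A).
Proof.
move=> Ap ap; rewrite face_op_cls; last exact: cjoin_polytope.
rewrite dim_cjoin // -(cone_sum k.+1 Ap ap) (face_op_cls k Ap).
have dF F : faces A F -> dim (cjoin F p) = (dim F).+1.
  by move=> FA; apply: dim_cjoin;
    [exact: face_polytope FA | exact: apartS (faces_sub FA) ap].
set S2 := (@cjoin R d)^~ p @` _;
  pose S1 := [set F | faces A F /\ (dim F + k)%N = dim A].
pose S3 := [set X | X = [set p] /\ (k == dim A)].
have fS1 : finite_set S1 by exact: finite_codim_faces.
have fS2 : finite_set S2 by apply/finite_image/finite_codim_faces.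
have fS3 : finite_set S3 by apply: (sub_finite_set _ (finite_set1 [set p]))
  => X [].
rewrite (_ : [set F | _] = S2 `|` S1 `|` S3).
  rewrite fsbigU0 //; first last.
  - move=> X [[[F [FA _] <-]|[XA _]] [e _]].
      have [x Fx] := faces_nonempty FA.
      have : [set p] x by rewrite -e; apply: cjoin_base.
      by move=> /= xp; apply: (apart_notin ap); rewrite -xp;
        apply: faces_sub Fx.
    by apply: (apart_notin ap); apply: (faces_sub XA); rewrite e.
  - by rewrite finite_setU.
  rewrite fsbigU0 //; last first.
    by move=> X [[F [FA _] <-]] [XA _]; apply/(apart_notin ap)/(faces_sub XA);
      left.
  by rewrite fsbig_point (cls_point p (0 : 'rV_0)).
apply/seteqP; split=> X /=.
  case=> /cjoin_facesP[->|XA|[F FA ->]].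
  - by rewrite dim_point add0n => -[e]; right; split=> //; apply/eqP.
  - by rewrite addnS => -[e]; left; right; split.
  - by rewrite (dF F FA) addSn => -[e]; left; left; exists F.
case=> [[[F [FA e] <-]|[XA e]]|[-> /eqP <-]].
- by rewrite (dF F FA) -e addSn; split=> //; apply: cjoin_faces_cone.
- by rewrite addnS e; split=> //; apply: cjoin_faces_base.
- by rewrite dim_point add0n; split=> //; apply: cjoin_faces_apex.
Qed.

End ConeOperator.

(** * The faces of the bipyramid *)

Section Bipyramid.
Variable R : realType.
Local Notation PG := (polytope_group R).

Section Faces.
Variables (d : nat) (A : set 'rV[R]_d) (p q x0 : 'rV[R]_d).
Hypotheses (Ap : is_polytope A) (ap : apart A p) (pq : p + q = 2 *: x0).
Hypotheses (Ax0 : A x0) (x0A : forall F, faces A F -> F x0 -> A `<=` F).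

(** The segment from p to q crosses A at its midpoint [x0], a relative interior point. The second
    join is not a pyramid, as q lies in the affine hull of the first; [cjoin_polytope] and
    [cjoin_expose] apply to it nevertheless. *)
Let B := cjoin (cjoin A p) q.

Lemma dotp_q u : dotp q u = 2 * dotp x0 u - dotp p u.
Proof. by rewrite -dotpZ -pq dotpD addrAC subrr add0r. Qed.

Lemma apart_q : apart A q.
Proof.
have [w [c [Aw pw]]] := ap; exists w, c; split=> //.
by rewrite dotp_q (Aw x0) // => e; apply: pw; move: e; lra.
Qed.

Lemma bipyramid_polytope : is_polytope B.
Proof. exact/cjoin_polytope/cjoin_polytope. Qed.

Lemma dim_bipyramid : dim B = (dim A).+1.
Proof.
apply/eqP; rewrite eqn_leq; apply/andP; split; last first.
  rewrite -(dim_cjoin Ap ap); apply: dimS; last exact: cjoin_base.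
  by exists p; left.
have A0 := is_polytope_nonempty Ap.
have [x [M [Ax _ _ sM]]] := dim_basis A0.
have dir (S : set 'rV[R]_d) r : (forall y, S y ->
  (y - x <= col_mx M (p - x))%MS) ->
    (r - x <= col_mx M (p - x))%MS ->
    forall y, cjoin S r y -> (y - x <= col_mx M (p - x))%MS.
  move=> hS hr y [->//|[z [t [Sz _ ->]]]].
  have -> : (1 - t) *: z + t *: r - x = (1 - t) *: (z - x) + t *: (r - x).
    by rewrite !scalerBr addrACA -opprD -scalerDl subrK scale1r.
  by apply: addmx_sub; apply: scalemx_sub => //; apply: hS.
apply: (@leq_trans (\rank (col_mx M (p - x)))); last first.
  by apply: leq_trans (rank_leq_row _) _; rewrite addn1.
have Msub z : A z -> (z - x <= col_mx M (p - x))%MS.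
  by move=> Az; rewrite -addsmxE; apply: submx_trans (addsmxSl _ _); apply: sM.
have psub : (p - x <= col_mx M (p - x))%MS by rewrite -addsmxE addsmxSr.
apply: (dim_le_rank (x := x)); first by exists q; exact: cjoin_apex.
apply: (dir (cjoin A p)); first exact: dir.
have -> : q - x = 2 *: (x0 - x) - (p - x).
  by rewrite scalerBr -pq !scaler_nat mulr2n; apply/eqP; rewrite -subr_eq0;
    apply/eqP/rowP => i; rewrite !mxE; ring.
apply: addmx_sub; last by rewrite eqmx_opp.
exact: scalemx_sub (Msub _ Ax0).
Qed.

(** A functional takes at [x0] the mean of its values at p and q. If both are maximal, so is the one
    at [x0], and everything is exposed; otherwise [x0] stays below the maximum and the trace on A is
    proper or empty. *)
Lemma bipyramid_facesP X : faces B X ->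
  [\/ X = B, [\/ X = [set p] | X = [set q]] |
    exists F, [/\ faces A F, F <> A &
      [\/ X = F, X = cjoin F p | X = cjoin F q]]].
Proof.
move=> [X0 [u [c [uc XE]]]].
have uA x : A x -> dotp x u <= c by move=> Ax; apply/uc/cjoin_base/cjoin_base.
have uAp x : cjoin A p x -> dotp x u <= c by move=> Ax; apply/uc/cjoin_base.
have up : dotp p u <= c by apply/uAp/cjoin_apex.
have uq : dotp q u <= c by apply/uc/cjoin_apex.
pose F := [set x | A x /\ dotp x u = c].
have FA : F !=set0 -> faces A F by move=> F0; split=> //; exists u, c.
have FP : F = set0 \/ faces A F.
  by have [->|/eqP/set0P/FA] := pselect (F = set0); [left|right].
have nFA : dotp x0 u < c -> F <> A.
  by move=> h E; move: Ax0; rewrite -E => -[_ e]; rewrite e ltxx in h.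
move: XE; rewrite cjoin_expose // cjoin_expose //= -/F; rewrite dotp_q in uq *.
case: (eqVneq (dotp p u) c) => pe; case: eqP => qe XE.
- have Fx0 : F x0 by split=> //; move: qe; rewrite pe; lra.
  constructor 1; rewrite XE /B; congr (cjoin (cjoin _ _) _); apply/seteqP.
  by split=> [x []//|]; apply: x0A => //; apply: FA; exists x0.
- have ne : F <> A by apply: nFA; move/eqP: qe uq; rewrite pe neq_lt; lra.
  case: FP => [F0|FA']; first by constructor 2; left; rewrite XE F0 cjoin0.
  by constructor 3; exists F; split=> //; constructor 2.
- have ne : F <> A by apply: nFA; move: pe up qe; rewrite neq_lt; lra.
  case: FP => [F0|FA']; first by constructor 2; right; rewrite XE F0 cjoin0.
  by constructor 3; exists F; split=> //; constructor 3.
- have ne : F <> A by apply: nFA; move: pe up uq; rewrite neq_lt; lra.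
  case: FP => [F0|FA']; first by move: X0; rewrite XE F0 => -[].
  by constructor 3; exists F; split=> //; constructor 1.
Qed.

(* The values at p and q may be shifted in opposite directions without
  changing those on A. *)
Lemma bipyramid_tilt F (r : R) : faces A F -> F <> A ->
  exists u c, [/\ forall x, A x ->
    dotp x u <= c, F = [set x | A x /\ dotp x u = c],
    dotp x0 u < c & dotp p u = (1 - r) * dotp x0 u + r * c].
Proof.
move=> FA nFA; have [F0 [u [c [uc FE]]]] := FA; have [w [e [Aw pw]]] := ap.
have nz : dotp p w - e != 0 by rewrite subr_eq0; apply/eqP.
have lt0 : dotp x0 u < c.
  rewrite lt_neqAle uc // andbT; apply/eqP => E; apply: nFA.
  by apply/seteqP; split; [exact: faces_sub | apply: x0A => //; rewrite FE].
pose s := ((1 - r) * dotp x0 u + r * c - dotp p u) / (dotp p w - e).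
have sE : s * (dotp p w - e) =
  (1 - r) * dotp x0 u + r * c - dotp p u by rewrite divfK.
have uA x : A x -> dotp x (u + s *: w) = dotp x u + s * e.
  by move=> Ax; rewrite dotpDr dotpZr Aw.
exists (u + s *: w), (c + s * e); split.
- by move=> x Ax; rewrite uA // lerD2r uc.
- rewrite FE; apply/seteqP.
  by split=> x /= -[Ax]; rewrite uA // => h; split=> //; move: h;
    [move=> -> | move/addIr].
- by rewrite (uA _ Ax0) ltrD2r.
- by rewrite (uA _ Ax0) dotpDr dotpZr; move: sE; lra.
Qed.

Lemma bipyramid_faces_base F : faces A F -> F <> A ->
  [/\ faces B F, faces B (cjoin F p) & faces B (cjoin F q)].
Proof.
move=> FA nFA; have [x Fx] := faces_nonempty FA; split.
(* A tilt by [r] at p is a tilt by [- r] at q, in units of the gap between [x0] and the maximum: 0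
   leaves both apices below, 1 lifts p to the maximum, and -1 lifts q. *)
- have [u [c [uc FE lt0 up]]] := bipyramid_tilt 0 FA nFA.
  have pc : dotp p u < c by rewrite up; lra.
  have qc : dotp q u < c by rewrite dotp_q up; lra.
  have le1 := dotp_cjoin_le uc (ltW pc); have le2 := dotp_cjoin_le le1 (ltW qc).
  split; first by exists x.
  exists u, c; split=> //;
    rewrite cjoin_expose ?(ltW qc) // cjoin_expose ?(ltW pc) //=.
  by rewrite (lt_eqF pc) (lt_eqF qc) -FE.
- have [u [c [uc FE lt0 up]]] := bipyramid_tilt 1 FA nFA.
  have pc : dotp p u = c by rewrite up; lra.
  have qc : dotp q u < c by rewrite dotp_q pc; lra.
  have le1 : forall y, cjoin A p y -> dotp y u <= c by apply: dotp_cjoin_le;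
    rewrite ?pc.
  have le2 := dotp_cjoin_le le1 (ltW qc).
  split; first by exists p; left.
  exists u, c; split=> //;
    rewrite cjoin_expose ?(ltW qc) // cjoin_expose ?pc //=.
  by rewrite (lt_eqF qc) eqxx -FE.
- have [u [c [uc FE lt0 up]]] := bipyramid_tilt (- 1) FA nFA.
  have pc : dotp p u < c by rewrite up; lra.
  have qc : dotp q u = c by rewrite dotp_q up; lra.
  have le1 := dotp_cjoin_le uc (ltW pc).
  have le2 : forall y, cjoin (cjoin A p) q y ->
    dotp y u <= c by apply: dotp_cjoin_le; rewrite ?qc.
  split; first by exists q; exact: cjoin_apex.
  exists u, c; split=> //;
    rewrite cjoin_expose ?qc // cjoin_expose ?(ltW pc) //=.
  by rewrite (lt_eqF pc) eqxx -FE.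
Qed.

Lemma bipyramid_faces_apex : faces B [set p] /\ faces B [set q].
Proof.
have [w [e [Aw pw]]] := ap; pose s := (dotp p w - e)^-1.
have nz : dotp p w - e != 0 by rewrite subr_eq0; apply/eqP.
have sE : s * dotp p w = s * e + 1.
  have : s * (dotp p w - e) = 1 by rewrite mulVf.
  lra.
have uA x : A x -> dotp x (s *: w) = s * e by move=> Ax; rewrite dotpZr Aw.
have up : dotp p (s *: w) = s * e + 1 by rewrite dotpZr.
have uq : dotp q (s *: w) = s * e - 1 by rewrite dotp_q (uA _ Ax0) up; lra.
split.
- have le0 x : A x -> dotp x (s *: w) <= s * e + 1 by move=> /uA ->; lra.
  have le1 : forall y, cjoin A p y ->
    dotp y (s *: w) <= s * e + 1 by apply: dotp_cjoin_le; rewrite ?up.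
  have qc : dotp q (s *: w) < s * e + 1 by rewrite uq; lra.
  have le2 := dotp_cjoin_le le1 (ltW qc).
  split; first by exists p.
  exists (s *: w), (s * e + 1); split=> //;
    rewrite cjoin_expose ?(ltW qc) // cjoin_expose ?up //=.
  rewrite (lt_eqF qc) eqxx -cjoin0; congr (cjoin _ p); apply/seteqP;
    split=> // x [/uA ->]; lra.
- have ap' x : A x -> dotp x (- (s *: w)) = - (s * e) by move=> Ax;
    rewrite dotpNr uA.
  have pc : dotp p (- (s *: w)) < - (s * e) + 1 by rewrite dotpNr up; lra.
  have qc : dotp q (- (s *: w)) = - (s * e) + 1 by rewrite dotpNr uq; lra.
  have le0 x : A x -> dotp x (- (s *: w)) <= - (s * e) + 1 by move=> /ap' ->;
    lra.
  have le1 := dotp_cjoin_le le0 (ltW pc).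
  have le2 : forall y, cjoin (cjoin A p) q y ->
    dotp y (- (s *: w)) <= - (s * e) + 1 by apply: dotp_cjoin_le; rewrite ?qc.
  split; first by exists q.
  exists (- (s *: w)), (- (s * e) + 1); split=> //;
    rewrite cjoin_expose ?qc // cjoin_expose ?(ltW pc) //=.
  rewrite (lt_eqF pc) eqxx -cjoin0; congr (cjoin _ q); apply/seteqP;
    split=> // x [/ap' ->]; lra.
Qed.

(** The count of [face_op_cone] with two apices, except that A itself is no longer a face: hence the
    condition [k != 0]. *)
Lemma face_op_bipyramid k :
  face_op R k.+1 (cls B) = cone_op (face_op R k.+1 (cls A)) *+ 2 +
    face_op R k (cls A) *+ (k != 0%N) + pt R *+ (k == dim A) *+ 2.
Proof.
have aq := apart_q; have pA := apart_notin ap; have qA := apart_notin aq.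
rewrite face_op_cls; last exact: bipyramid_polytope.
rewrite dim_bipyramid mulr2n -{1}(cone_sum k.+1 Ap ap) -(cone_sum k.+1 Ap aq).
have dF F r : faces A F -> apart A r -> dim (cjoin F r) = (dim F).+1.
  by move=> FA ar; apply: dim_cjoin;
    [exact: face_polytope FA | exact: apartS (faces_sub FA) ar].
have [w [e [Aw pw]]] := ap.
have qw : dotp q w = 2 * e - dotp p w by rewrite dotp_q Aw.
have npq : p <> q by move=> E; apply: pw; move: qw; rewrite -E; lra.
have ncp F : F `<=` A -> ~ cjoin F p q.
  move=> FA [/esym//|[x [t [/FA/Aw xe /andP[t0 t1] E]]]].
  have := congr1 (fun z => dotp z w) E; rewrite dotpD !dotpZ xe qw => h.
  have : (1 + t) * (dotp p w - e) = 0 by move: h; lra.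
  by move/eqP; rewrite mulf_eq0 subr_eq0 => /orP[/eqP|/eqP//]; lra.
pose S1 := [set F | faces A F /\ (F <> A /\ (dim F + k)%N = dim A)].
have S1E : \sum_(X \in S1) cls X = face_op R k (cls A) *+ (k != 0%N).
  rewrite {}/S1; case: k => [|k] /=.
    rewrite mulr0n fsbig1 // => F [FA [nFA]];
      rewrite addn0 => /(face_dim_eq FA).
    by move/nFA.
  rewrite mulr1n (face_op_cls k.+1 Ap); apply: eq_fsbigl; apply/seteqP;
    split=> F /=.
    by case=> FA [].
  move=> [FA h]; split=> //; split=> // E; move: h; rewrite E => /eqP.
  by rewrite -[X in _ == X]addn0 eqn_add2l.
set SA := (@cjoin R d)^~ p @` _; set SB := (@cjoin R d)^~ q @` _.
pose Sp := [set X | X = [set p] /\ (k == dim A)].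
pose Sq := [set X | X = [set q] /\ (k == dim A)].
have fS1 : finite_set S1 by exact: finite_codim_faces.
have fSA : finite_set SA by apply/finite_image/finite_codim_faces.
have fSB : finite_set SB by apply/finite_image/finite_codim_faces.
have fSp : finite_set Sp by apply: (sub_finite_set _ (finite_set1 [set p]))
  => X [].
have fSq : finite_set Sq by apply: (sub_finite_set _ (finite_set1 [set q]))
  => X [].
have SAp X : SA X -> X p by move=> [F _ <-]; left.
have SBq X : SB X -> X q by move=> [F _ <-]; left.
have S1A X : S1 X -> X `<=` A by case=> /faces_sub.
have SAnq X : SA X -> ~ X q.
  by move=> [F [FA _] <-]; apply: ncp; apply: faces_sub.
have SA_A X : SA X -> exists2 x, A x & X x.
  move=> [F [FA _] <-]; have [x Fx] := faces_nonempty FA.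
  by exists x; [exact: faces_sub Fx | exact: cjoin_base].
have SB_A X : SB X -> exists2 x, A x & X x.
  move=> [F [FA _] <-]; have [x Fx] := faces_nonempty FA.
  by exists x; [exact: faces_sub Fx | exact: cjoin_base].
rewrite (_ : [set F | _] = SA `|` SB `|` S1 `|` (Sp `|` Sq)).
  rewrite fsbigU0 ?finite_setU //; last first.
    move=> X [[[XA|XB]|X1] [[E _]|[E _]]].
    - by have [x Ax] := SA_A X XA; rewrite E => xp; apply: pA; rewrite -xp.
    - by have [x Ax] := SA_A X XA; rewrite E => xp; apply: qA; rewrite -xp.
    - by have [x Ax] := SB_A X XB; rewrite E => xp; apply: pA; rewrite -xp.
    - by have [x Ax] := SB_A X XB; rewrite E => xp; apply: qA; rewrite -xp.
    - by apply: pA; apply: (S1A X X1); rewrite E.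
    - by apply: qA; apply: (S1A X X1); rewrite E.
  rewrite fsbigU0 ?finite_setU //; last first.
    move=> X [[XA|XB] X1].
      by apply: pA; apply: (S1A X X1); apply: SAp.
    by apply: qA; apply: (S1A X X1); apply: SBq.
  rewrite fsbigU0 //; last by move=> X [XA XB]; apply: (SAnq X XA); apply: SBq.
  rewrite fsbigU0 //; last first.
    move=> X [[E _] [E' _]]; apply: npq.
    by have : [set q] p by rewrite -E' E.
  by rewrite S1E !fsbig_point (cls_point p (0 : 'rV_0)) (cls_point q (0 :
    'rV_0)) [in RHS]mulr2n.
apply/seteqP; split=> X /=.
  case=> /bipyramid_facesP[->|[->|->]|[F [FA nFA [->|->|->]]]].
  - by rewrite dim_bipyramid => /eqP; rewrite -[X in _ == X]addn0 eqn_add2l.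
  - by rewrite dim_point add0n => -[h]; right; left; split=> //; apply/eqP.
  - by rewrite dim_point add0n => -[h]; right; right; split=> //; apply/eqP.
  - by rewrite addnS => -[h]; left; right; split.
  - by rewrite (dF F p FA ap) addSn => -[h]; left; left; left; exists F.
  - by rewrite (dF F q FA aq) addSn => -[h]; left; left; right; exists F.
have nA F j : (dim F + j.+1)%N = dim A -> F <> A.
  by move=> + E; rewrite E => /eqP; rewrite -[X in _ == X]addn0 eqn_add2l.
case=> [[[[F [FA h] <-]|[F [FA h] <-]]|[FA [nFA h]]]|[[-> /eqP <-]|[-> /eqP
  <-]]].
- by rewrite (dF F p FA ap) -h addSn; split=> //;
    case: (bipyramid_faces_base FA (nA _ _ h)).
- by rewrite (dF F q FA aq) -h addSn; split=> //;
    case: (bipyramid_faces_base FA (nA _ _ h)).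
- by rewrite addnS h; split=> //; case: (bipyramid_faces_base FA nFA).
- by rewrite dim_point add0n; split=> //; case: bipyramid_faces_apex.
- by rewrite dim_point add0n; split=> //; case: bipyramid_faces_apex.
Qed.

End Faces.
End Bipyramid.

(** * Relations between the face operators *)

Section Relations.
Variable R : realType.
Local Notation PG := (polytope_group R).

(** One list of all faces, with the conditions as predicates, allows the double sums below to be
    exchanged. *)
Lemma fsbig_cond_seq (U : zmodType) (I : choiceType) (S : set I) (P : pred I)
  (g : I -> U) :
  finite_set S ->
  \sum_(i \in [set i | S i /\ P i]) g i = \sum_(i <- fset_set S | P i) g i.
Proof.
move=> fS; rewrite -[RHS]big_filter [RHS]fsbig_seq ?filter_uniq //.
apply: eq_fsbigl; apply/seteqP; split=> i /=; rewrite mem_filter in_fset_set //.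
  by case=> Si ->; rewrite mem_set.
by case/andP => -> /set_mem.
Qed.

Lemma face_op_seq k d (A : set 'rV[R]_d) : is_polytope A ->
  face_op R k (cls A) = \sum_(F <- fset_set (faces A) | (dim F + k == dim
    A)%N) cls F.
Proof.
move=> Ap; rewrite face_op_cls // -fsbig_cond_seq; last exact: finite_faces.
by apply: eq_fsbigl; apply/seteqP; split=> F /= [FA] /eqP.
Qed.

Lemma mem_faces d (A : set 'rV[R]_d) F : is_polytope A ->
  F \in fset_set (faces A) -> faces A F.
Proof. by move=> Ap; rewrite in_fset_set;
  [exact: set_mem | exact: finite_faces]. Qed.

(** Apply [euler_interval] above the apex of the pyramid: there lie the apex, which contributes 1,
    and the cones over the faces of A, whose dimensions are raised by one. *)
Lemma euler_polytope d (A : set 'rV[R]_d) p : is_polytope A -> apart A p ->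
  \sum_(F <- fset_set (faces A)) ((-1) ^+ dim F : int) = 1.
Proof.
move=> Ap ap; have fA := finite_faces Ap.
rewrite -fsbig_finite //; apply/eqP; rewrite -subr_eq0 -oppr_eq0 opprB;
  apply/eqP.
have npA : [set p] <> cjoin A p.
  have [x Ax] := is_polytope_nonempty Ap.
  move=> E; have : cjoin A p x by apply: cjoin_base.
  by rewrite -E => /= xp; apply: (apart_notin ap); rewrite -xp.
rewrite -[RHS](euler_interval (cjoin_polytope p Ap) (cjoin_faces_apex ap) npA).
set S := (@cjoin R d)^~ p @` faces A.
rewrite (_ : [set F | _] = [set [set p]] `|` S).
  rewrite fsbigU0 //; last first.
    move=> X /= [-> [F FA E]]; have [x Fx] := faces_nonempty FA.
    have : cjoin F p x by apply: cjoin_base.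
    by rewrite E /= => xp; apply: (apart_notin ap); rewrite -xp;
      apply: faces_sub Fx.
    exact: finite_image.
  rewrite fsbig_set1 dim_point expr0 fsbig_image; last first.
    move=> F G /set_mem FA /set_mem GA.
    by apply: (cjoin_inj ap); apply: faces_sub.
  congr (_ + _); rewrite !fsbig_finite // -sumrN [LHS]big_seq [RHS]big_seq.
  apply: eq_bigr => F /(mem_faces Ap) FA.
  rewrite dim_cjoin ?exprS ?mulN1r //; first exact: face_polytope FA.
  exact: apartS (faces_sub FA) ap.
apply/seteqP; split=> X /=.
  case=> /cjoin_facesP[->|XA|[F FA ->]] pX; first by left.
    by case: (apart_notin ap); apply: (faces_sub XA); apply: pX.
  by right; exists F.
case=> [->|[F FA <-]]; first by split=> //; apply: cjoin_faces_apex.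
by split; [apply: cjoin_faces_cone | move=> _ ->; left].
Qed.

Lemma cls_apart d (A : set 'rV[R]_d) : is_polytope A ->
  exists d' (A' : set 'rV[R]_d') p,
    [/\ is_polytope A', apart A' p, dim A' = dim A & cls A = cls A'].
Proof.
move=> Ap; exists (d + 1)%N, (emb A), (row_mx 0 1); split.
- exact: emb_polytope.
- exact: (emb_apart _ _ (oner_neq0 R)).
- have Ep := emb_polytope Ap.
  apply/esym/(@comb_equiv_dim _ (Polytope Ap) (Polytope Ep)).
  by apply/comb_equivP; exists (@emb R d); apply: emb_iso.
- by rewrite cls_emb.
Qed.

Lemma xi_additive : zmod_morphism (@xi R).
Proof. exact: lift_is_additive. Qed.

HB.instance Definition _ := GRing.isZmodMorphism.Build PG {poly int} (@xi R)
  xi_additive.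

(** The functional equation in coefficients, with q standing for D p. On a polytope, a face F counts
    only for [i = dim F], and only if m is the dimension of the polytope; the sum is then that of
    [euler_polytope]. *)
Lemma xi_euler (q : PG) m :
  \sum_(i < m.+1) (-1) ^+ i * (xi (face_op R (m - i) q))`_i = (xi q)`_m.
Proof.
pose f q := \sum_(i < m.+1) (-1) ^+ i * (xi (face_op R (m - i) q))`_i.
rewrite -/(f q); apply: (additive_ext (f := f) (g := fun q => (xi q)`_m)) q.
- move=> x y; rewrite /f -sumrB; apply: eq_bigr => i _.
  by rewrite raddfB raddfB coefB mulrBr.
- by move=> x y; rewrite raddfB coefB.
move=> d0 A0 A0p; have [d [A [p [Ap ap _ ->]]]] := cls_apart A0p;
  rewrite /f xi_cls // coefXn.
transitivity (\sum_(F <- fset_set (faces A)) \sum_(i < m.+1)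
    ((-1) ^+ i * ((dim F + (m - i) == dim A)%N && (dim F == i :> nat))%:R :
      int)).
  rewrite exchange_big /=; apply: eq_bigr => i _.
  rewrite face_op_seq // raddf_sum coef_sum mulr_sumr big_mkcond /=.
  rewrite [LHS]big_seq [RHS]big_seq; apply: eq_bigr => F /(mem_faces Ap) FA.
  case: ifP => _; rewrite ?mulr0 //= xi_cls; last exact: face_polytope FA.
  by rewrite coefXn eq_sym.
transitivity (\sum_(F <- fset_set (faces A)) ((m == dim A)%:R * (-1) ^+ dim F
  : int)); last first.
  by rewrite -mulr_sumr (euler_polytope Ap ap) mulr1.
rewrite [LHS]big_seq [RHS]big_seq; apply: eq_bigr => F /(mem_faces Ap) FA.
have dF := face_dim_le FA.
have [Fm|Fm] := leqP (dim F) m; last first.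
  rewrite big1 => [|i _].
    by rewrite (_ : (m == dim A) = false) ?mul0r //; apply/eqP; lia.
  rewrite (_ : (dim F == i :> nat) = false) ?andbF ?mulr0 //.
  by apply/eqP => e; have := ltn_ord i; lia.
rewrite (bigD1 (Ordinal (Fm : (dim F < m.+1)%N))) //= big1 ?addr0.
  by rewrite eqxx andbT subnKC // mulrC.
by move=> i; rewrite -val_eqE /= eq_sym => /negPf ->; rewrite andbF mulr0.
Qed.

Lemma face_op_seq_sub k d (A : set 'rV[R]_d) F : is_polytope A -> faces A F ->
  face_op R k (cls F) =
  \sum_(G <- fset_set (faces A) | `[< G `<=` F >] && (dim G + k == dim F)%N)
    cls G.
Proof.
move=> Ap FA; rewrite face_op_cls; last exact: face_polytope FA.
rewrite -fsbig_cond_seq; last exact: finite_faces.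
apply: eq_fsbigl; apply/seteqP; split=> G /=.
  move=> [GF e]; split; first exact: face_trans Ap FA GF.
  by rewrite e eqxx andbT; apply/asboolP; exact: faces_sub GF.
by case=> GA /andP[/asboolP GF /eqP e]; split=> //; exact: sub_face FA GA GF.
Qed.

(** On a polytope A the coefficient of a face G is a sum over the faces F between G and A, with [i]
    equal to [dim F - dim G]. It is empty unless G has codimension m, and then [0 < m] makes G
    proper, so that [euler_interval] applies. *)
Lemma face_op_relation (q : PG) m : (0 < m)%N ->
  \sum_(i < m.+1) face_op R i (face_op R (m - i) q) *~ ((-1) ^+ i) = 0.
Proof.
move=> m0; pose f q := \sum_(i < m.+1) face_op R i (face_op R (m - i) q) *~
  ((-1) ^+ i).
rewrite -/(f q); apply: (additive_ext (f := f) (g := fun=> 0)) q.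
- move=> x y; rewrite /f -sumrB; apply: eq_bigr => i _.
  by rewrite !raddfB mulrzBl.
- by move=> x y; rewrite subr0.
move=> d A Ap; have fA := finite_faces Ap; rewrite /f.
pose r := fset_set (faces A).
pose c (i : nat) (F G : set 'rV[R]_d) := (dim F + (m - i) == dim A)%N && (`[<
  G `<=` F >] && (dim G + i == dim F)%N).
transitivity (\sum_(i < m.+1) \sum_(G <- r) \sum_(F <- r) cls G *~ ((c i F
  G)%:R * (-1) ^+ i)).
  apply: eq_bigr => i _;
    rewrite exchange_big /= face_op_seq // raddf_sum mulrz_suml.
  rewrite big_mkcond /= [LHS]big_seq [RHS]big_seq;
    apply: eq_bigr => F /(mem_faces Ap) FA.
  case: ifP => cF; last by rewrite big1 // => G _; rewrite /c cF mul0r mulr0z.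
  rewrite (face_op_seq_sub _ Ap FA) mulrz_suml big_mkcond /=;
    apply: eq_bigr => G _.
  by rewrite /c cF /=; case: ifP; rewrite ?mul1r // mul0r mulr0z.
rewrite exchange_big big1_seq //= => G /(mem_faces Ap) GA.
rewrite exchange_big /=; under eq_bigr do rewrite -mulrz_sumr.
rewrite -mulrz_sumr; suff ->
  : \sum_(F <- r) \sum_(i < m.+1) ((c i F G)%:R * (-1) ^+ i : int) = 0.
  by rewrite mulr0z.
transitivity (\sum_(F <- r) (dim G + m == dim A)%:R * (-1) ^+ dim G *
    ((`[< G `<=` F >])%:R * (-1) ^+ dim F : int)).
  rewrite [LHS]big_seq [RHS]big_seq; apply: eq_bigr => F /(mem_faces Ap) FA.
  have [GF|GF] := asboolP; last first.
    by rewrite mul0r mulr0 big1 // => i _; rewrite /c asboolF // andbF mul0r.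
  have dF := face_dim_le FA; have dG := face_dim_le (sub_face FA GA GF).
  rewrite mul1r -mulrA -exprD; have [e|ne] := eqVneq (dim G + m)%N (dim A);
    last first.
    rewrite mul0r big1 // => i _; rewrite /c (_ : (_ && _) = false) ?mul0r //.
    by apply/negP => /and3P[/eqP h1 _ /eqP h2]; move/eqP: ne;
      have := ltn_ord i; lia.
  have hi : (dim F - dim G < m.+1)%N by lia.
  rewrite mul1r (bigD1 (Ordinal hi)) //= big1 ?addr0.
    have -> : c (dim F - dim G)%N F G by rewrite /c asboolT //=; apply/andP;
      split; apply/eqP; lia.
    by rewrite mul1r -signr_odd -[RHS]signr_odd oddB // oddD addbC.
  move=> i; rewrite -val_eqE /= => /eqP ni.
  rewrite /c (_ : (_ && _) = false) ?mul0r //.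
  by apply/negP => /and3P[/eqP h1 _ /eqP h2]; apply: ni; lia.
rewrite -mulr_sumr; have [e|ne] := eqVneq (dim G + m)%N (dim A);
  last by rewrite !mul0r.
have nGA : G <> A by move=> E; move: e; rewrite E; lia.
suff -> : \sum_(F <- r) ((`[< G `<=` F >])%:R * (-1) ^+ dim F : int) =
  0 by rewrite mulr0.
rewrite -[RHS](euler_interval Ap GA nGA).
rewrite (_ : [set F | _] = [set F | faces A F /\ `[< G `<=` F >]]); last first.
  by apply/seteqP; split=> F /= [FA /asboolP].
rewrite fsbig_cond_seq // -/r big_mkcond /= [RHS]big_mkcond;
  apply: eq_bigr => F _.
by case: asboolP; rewrite ?mul1r ?mul0r.
Qed.

Lemma cone_exists d (A : set 'rV[R]_d) : is_polytope A ->
  exists d' (C : set 'rV[R]_d'), [/\ is_polytope C, dim C = (dim A).+1,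
    cls C = cone_op (cls A) &
    forall k, face_op R k.+1 (cls C) =
      cone_op (face_op R k.+1 (cls A)) + face_op R k (cls A) + pt R *+ (k ==
        dim A)].
Proof.
move=> A0p; have [d' [A' [p [Ap ap <- ->]]]] := cls_apart A0p.
exists d', (cjoin A' p); split; first exact: cjoin_polytope.
- exact: dim_cjoin.
- by rewrite (cone_op_cls Ap ap).
- by move=> k; apply: face_op_cone.
Qed.

Lemma bipyramid_exists d (A : set 'rV[R]_d) : is_polytope A ->
  exists d' (B : set 'rV[R]_d'), [/\ is_polytope B, dim B = (dim A).+1 &
    forall k, face_op R k.+1 (cls B) = cone_op (face_op R k.+1 (cls A)) *+ 2 +
      face_op R k (cls A) *+ (k != 0%N) + pt R *+ (k == dim A) *+ 2].
Proof.
move=> A0p; have [d' [A' [p [Ap ap <- ->]]]] := cls_apart A0p.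
have [x [Ax xA]] := relint_point Ap (faces_self (is_polytope_nonempty Ap)).
have pq : p + (2 *: x - p) = 2 *: x by rewrite addrC subrK.
exists d', (cjoin (cjoin A' p) (2 *: x - p)); split.
- exact: bipyramid_polytope.
- exact: (dim_bipyramid Ap ap pq).
- by move=> k; apply: (face_op_bipyramid Ap ap pq).
Qed.

End Relations.

(** * The ring D *)

Section DRing.
Variable R : realType.
Local Notation PG := (polytope_group R).
Local Notation D := (Dring R).

Definition ev (p : PG) (T : D) : PG := (val T : endo PG) p.

Lemma ev_additive p : zmod_morphism (ev p).
Proof. by []. Qed.

HB.instance Definition _ p := GRing.isZmodMorphism.Build D PG (ev p)
  (ev_additive p).

Lemma evM p (S T : D) : ev p (S * T) = ev (ev p T) S.
Proof. by []. Qed.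

Lemma ev_dD p k : ev p (dD R k) = face_op R k p.
Proof. by []. Qed.

Lemma ev1 p : ev p 1 = p.
Proof. by []. Qed.

Lemma xiB (p q : PG) : xi (p - q) = xi p - xi q.
Proof. exact: xi_additive. Qed.

Lemma xiD (p q : PG) : xi (p + q) = xi p + xi q.
Proof. exact: (raddfD (@xi R)). Qed.

Lemma evB p q T : ev (p - q) T = ev p T - ev q T.
Proof. exact: (raddfB (val T : endo PG)). Qed.

Lemma DringP (S T : D) : (forall p, ev p S = ev p T) -> S = T.
Proof. by move=> h; apply/val_inj/endoP. Qed.

Lemma dD0 : dD R 0 = 1.
Proof. by apply: DringP => p; rewrite ev_dD face_op0. Qed.

Definition word (s : seq nat) : D := \prod_(i <- s) dD R i.

Lemma word_cons k s : word (k :: s) = dD R k * word s.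
Proof. by rewrite /word big_cons. Qed.

Lemma word_rcons k s : word (rcons s k) = word s * dD R k.
Proof. by rewrite /word -cats1 big_cat big_seq1. Qed.

Lemma dD_relation m : (0 < m)%N ->
  \sum_(i < m.+1) (dD R i * dD R (m - i)) *~ ((-1) ^+ i) = 0 :> D.
Proof.
move=> m0; apply: DringP => p;
  rewrite raddf_sum raddf0 -[RHS](face_op_relation p m0).
by apply: eq_bigr => i _; rewrite raddfMz.
Qed.

Definition reduced_span : set D :=
  subgroup_gen [set T | exists s, all (leq 2) s /\ (T = word s \/ T =
    dD R 1 * word s)].

Lemma reduced_span_mul k T : (0 < k)%N -> reduced_span T ->
  reduced_span (dD R k * T).
Proof.
move=> k0; have [Ugen U0 UB UD] := subgroup_gen_closed
  [set T : D | exists s, all (leq 2) s /\ (T = word s \/ T = dD R 1 * word s)].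
have UMz (x : D) (b : nat) : reduced_span x -> reduced_span (x *~ (-1) ^+ b).
  move=> Ux; rewrite -signr_odd; case: (odd b); rewrite ?expr1 ?expr0 //.
  by rewrite mulrNz mulr1z -sub0r; apply: UB.
have UN (x : D) : reduced_span (- x) -> reduced_span x.
  by move=> Ux; rewrite -[x]opprK -sub0r; apply: UB.
have dd j s : (0 < j)%N -> all (leq 2) s -> reduced_span (dD R j * word s).
  move=> j0 hs; apply: Ugen; case: j j0 => [//|[|j]] _; first by exists s;
    split=> //; right.
  by exists (j.+2 :: s); split=> //; left; rewrite word_cons.
move: T; apply: (subgroup_gen_ind (P := fun T => reduced_span (dD R k * T))).
- by rewrite mulr0.
- by move=> x y Ux Uy; rewrite mulrBr; apply: UB.
move=> _ [s [hs [->|->]]]; first exact: dd.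
(* In degree [k.+1] the product d_k d_1 is the term of index k, with a sign as coefficient. The two
   extreme terms are d_(k+1), and in the others the second factor has index at least 2, so that [dd]
   applies to all of them. *)
have := congr1 (fun x => x * word s) (dD_relation (ltn0Sn k)).
have kk : (k < k.+2)%N by rewrite ltnS.
rewrite /= mul0r (bigD1 (Ordinal kk)) //= mulrDl => /eqP;
  rewrite addr_eq0 => /eqP.
rewrite subSnn mulrzAl -mulrA => e.
suff : reduced_span (dD R k * (dD R 1 * word s) *~ (-1) ^+ k).
  by move=> /(UMz _ k);
    rewrite -mulrzA -exprD addnn -mul2n exprM sqrrN !expr1n mulr1z.
rewrite e; apply: UN; rewrite opprK mulr_suml.
apply: (big_ind reduced_span) => // i; rewrite -val_eqE /= => ik.
rewrite mulrzAl; apply: UMz; rewrite -mulrA.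
have [i0|i0] := posnP i; first by rewrite i0 dD0 mul1r subn0; apply: dd.
have [ik1|ik1] := eqVneq (i : nat) k.+1.
  by rewrite ik1 subnn dD0 mul1r; apply: dd.
rewrite -word_cons; apply: dd => //=; rewrite hs andbT.
by move/eqP: ik; move/eqP: ik1; have := ltn_ord i; lia.
Qed.

(** The elements whose left multiplication preserves the span form a subring containing the d_k. As
    [Dset] is a set of endomorphisms, the argument runs through [val]. *)
Lemma reduced_spanT (T : D) : reduced_span T.
Proof.
have [Ugen U0 UB UD] := subgroup_gen_closed
  [set T : D | exists s, all (leq 2) s /\ (T = word s \/ T = dD R 1 * word s)].
pose good (S : D) := forall T, reduced_span T -> reduced_span (S * T).
have sub1 : reduced_span 1.
  by apply: Ugen; exists [::]; split=> //; left; rewrite /word big_nil.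
suff goodT : good T by rewrite -[T]mulr1; apply: goodT.
have [S gS ST] : exists2 S : D, good S & val S = val T.
  have /set_mem h : val T \in @Dset R := valP T.
  apply: (h [set f | exists2 S : D, good S & val S = f]); split.
    split.
    - by apply/mem_set; exists 1 => // S; rewrite mul1r.
    - move=> x y /set_mem[S gS <-] /set_mem[S' gS' <-]; apply/mem_set.
      by exists (S - S') => // U hU; rewrite mulrBl; apply: UB;
        [apply: gS|apply: gS'].
    - move=> x y /set_mem[S gS <-] /set_mem[S' gS' <-]; apply/mem_set.
      by exists (S * S') => // U hU; rewrite -mulrA; exact: gS (gS' _ hU).
  move=> _ [k k0 <-]; exists (dD R k) => // U hU; exact: reduced_span_mul.
by have <- : S = T by apply: val_inj.
Qed.

Lemma graded_cls d (A : set 'rV[R]_d) : is_polytope A ->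
  graded_part (dim A) (cls A).
Proof.
move=> Ap; have [Ugen _ _ _] := subgroup_gen_closed
  [set generator Q | Q in [set Q : polytope R | dim Q = dim A]].
by apply: Ugen; exists (Polytope Ap) => //; rewrite (clsE Ap).
Qed.

Lemma graded_ind n (P : PG -> Prop) : P 0 -> (forall p q, P p -> P q ->
  P (p - q)) ->
  (forall d (A : set 'rV[R]_d), is_polytope A -> dim A = n -> P (cls A)) ->
  forall p, graded_part n p -> P p.
Proof.
move=> P0 PB PA; apply: subgroup_gen_ind => // _ [Q dQ <-].
by rewrite -cls_polytope; apply: PA => //; apply: polytopeP.
Qed.

Lemma graded_closed n :
  [/\ @graded_part R n 0,
      forall p q : PG, graded_part n p -> graded_part n q ->
        graded_part n (p - q) &
      forall p q : PG, graded_part n p -> graded_part n q ->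
        graded_part n (p + q)].
Proof. by have [_ ? ? ?] := subgroup_gen_closed [set generator Q | Q in [set
  Q : polytope R | dim Q = n]]. Qed.

Lemma graded_Mz n (p : PG) (z : int) : graded_part n p ->
  graded_part n (p *~ z).
Proof.
have [g0 gB gD] := graded_closed n => gp.
have gM k : graded_part n (p *+ k) by elim: k => [|k IH];
  rewrite ?mulr0n // mulrS; apply: gD.
by case: z => k; [exact: gM | rewrite NegzE mulrNz -sub0r;
  apply: (gB _ _ g0 (gM k.+1))].
Qed.

(* Multiplication of a cd-index by c on the right: two cones minus a
  bipyramid. *)
Lemma c_operator m (Q : PG) : graded_part m Q ->
  exists p, [/\ graded_part m.+1 p, xi p = 'X * xi Q &
    forall k, face_op R k.+2 p = face_op R k.+1 Q].
Proof.
have [g0 gB gD] := graded_closed m.+1.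
move: Q; apply: graded_ind.
- by exists 0; split=> // [|k]; rewrite !raddf0 ?mulr0.
- move=> p q [p' [gp xp fp]] [q' [gq xq fq]]; exists (p' - q'); split;
    first exact: gB.
    by rewrite !xiB xp xq mulrBr.
  by move=> k; rewrite !raddfB fp fq.
move=> d A Ap dA; have [d1 [C [Cp dC eC fC]]] := cone_exists Ap.
have [d2 [B [Bp dB fB]]] := bipyramid_exists Ap.
exists (cls C *+ 2 - cls B); split.
- have gC : graded_part m.+1 (cls C) by rewrite -dA -dC; apply: graded_cls.
  have gBp : graded_part m.+1 (cls B) by rewrite -dA -dB; apply: graded_cls.
  by rewrite mulr2n; apply: (gB) => //; apply: gD.
- by rewrite xiB mulr2n xiD !xi_cls // dC dB addrK -exprS.
(* Cone terms and point terms cancel, leaving two copies of [face_op R k.+1] minus one. Index 1 is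
   left out because there the bipyramid formula lacks this last copy. *)
- move=> k; rewrite raddfB raddfMn /= fC fB /= mulr1n !mulrnDl.
  rewrite -[X in X - _]addrAC -[X in _ - X]addrAC opprD addrACA subrr add0r.
  by rewrite mulr2n addrK.
Qed.

(* Multiplication of a cd-index by d on the right: the cone and the bipyramid
  do not commute. *)
Lemma d_operator m (Q : PG) : graded_part m Q ->
  exists p, [/\ graded_part m.+2 p, xi p = 0, face_op R 2 p = Q &
    forall k, face_op R k.+3 p = 0].
Proof.
have [g0 gB gD] := graded_closed m.+2.
move: Q; apply: graded_ind.
- by exists 0; split=> // [||k]; rewrite !raddf0.
- move=> p q [p' [gp xp fp f0p]] [q' [gq xq fq f0q]]; exists (p' - q'); split;
    first exact: gB.
  + by rewrite xiB xp xq subrr.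
  + by rewrite !raddfB fp fq.
  + by move=> k; rewrite !raddfB f0p f0q subrr.
move=> d A Ap dA; have [d1 [C [Cp dC eC fC]]] := cone_exists Ap.
have [d2 [B [Bp dB fB]]] := bipyramid_exists Ap.
have [d3 [BC [BCp dBC fBC]]] := bipyramid_exists Cp.
have [d4 [CB [CBp dCB eCB fCB]]] := cone_exists Bp.
(* The discrepancy comes from A being a facet of its pyramid but not a face of its bipyramid; only
   [k = 0] sees it. *)
have key k : face_op R k.+2 (cls BC - cls CB) =
  face_op R k (cls A) *+ (k == 0%N).
  rewrite raddfB fBC fCB (fC k) (fC k.+1) (fB k) (fB k.+1) dC dB !eqSS /=
    mulr1n.
  rewrite !(raddfD (@cone_op R)) !(raddfMn (@cone_op R)) /=.
  apply/eqP/freeg_eqP => y; rewrite !(coeffB, coeffD, coeffMn).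
  by case: k => [|k] /=; case: eqP => _; case: eqP => _ /=;
    rewrite ?mulr0n ?mulr1n; ring.
exists (cls BC - cls CB); split.
- by apply: gB; rewrite -dA; [rewrite -dC -dBC | rewrite -dB -dCB];
    apply: graded_cls.
- by rewrite xiB !xi_cls // dBC dCB dC dB subrr.
- by rewrite key mulr1n face_op0.
- by move=> k; rewrite key mulr0n.
Qed.

End DRing.

(** * The image of phi *)

Section Image.
Variable R : realType.
Local Notation PG := (polytope_group R).
Local Notation D := (Dring R).

Lemma face_op_graded n k (p : PG) : graded_part n p ->
  if (k <= n)%N then graded_part (n - k) (face_op R k p) else face_op R k p = 0.
Proof.
move: p; apply: (graded_ind (P := fun p =>
  if (k <= n)%N then graded_part (n - k) (face_op R k p) else face_op R k p =
    0)).
- rewrite raddf0; case: ifP => // _; by have [] := graded_closed R (n - k).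
- move=> p q; case: ifP => _; rewrite raddfB; last by move=> -> ->;
    rewrite subrr.
  by have [_ gB _] := graded_closed R (n - k); apply: gB.
move=> d A Ap dA; rewrite face_op_seq // big_seq_cond; case: ifP => kn.
  have [g0 gB gD] := graded_closed R (n - k).
  apply: (big_ind (graded_part (n - k))) =>
    // F /andP[/(mem_faces Ap) FA /eqP e].
  rewrite (_ : (n - k)%N = dim F); last by rewrite -dA -e addnK.
  by apply: graded_cls; apply: face_polytope FA.
rewrite big1 // => F /andP[_ /eqP e]; move/negP: kn; case.
by rewrite -dA -e leq_addl.
Qed.

Lemma word_graded n s (p : PG) : graded_part n p ->
  if (sumn s <= n)%N then graded_part (n - sumn s) (ev p (word R s)) else ev
    p (word R s) = 0.
Proof.
move=> gp; elim: s => [|a s IH]; first by rewrite /= subn0 /word big_nil ev1.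
rewrite word_cons evM ev_dD /=; move: IH; case: ifP => sn.
  move=> /(face_op_graded a); rewrite -subnDA addnC; case: ifP;
    case: ifP => //; lia.
by move=> ->; rewrite raddf0; case: ifP => //; lia.
Qed.

Lemma xi_graded n i (p : PG) : graded_part n p -> i <> n -> (xi p)`_i = 0.
Proof.
move=> + ne; move: p; apply: (graded_ind (P := fun p : PG => (xi p)`_i = 0)).
- by rewrite raddf0 coef0.
- by move=> p q e e'; rewrite xiB coefB e e' subrr.
- by move=> d A Ap dA; rewrite xi_cls // coefXn dA; case: eqP.
Qed.

Lemma phi_word n s i (p : PG) : graded_part n p -> (i + sumn s)%N <> n ->
  (phi p (word R s))`_i = 0.
Proof.
move=> gp ne; have := word_graded s gp; rewrite /phi -/(ev p _);
  case: ifP => sn.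
  by move=> /xi_graded; apply; lia.
by move=> ->; rewrite raddf0 coef0.
Qed.

Lemma phi_additive (p : PG) : zmod_morphism (phi p).
Proof. by move=> S T; exact: (xiB (ev p S) (ev p T)). Qed.

Lemma phiB (p q : PG) T : phi (p - q) T = phi p T - phi q T.
Proof. by rewrite -xiB; congr xi; exact: evB. Qed.

Lemma phi_graded n k i (p : PG) T : graded_part n p -> Dgraded k T ->
  (i + k)%N <> n -> (phi p T)`_i = 0.
Proof.
move=> gp + ne; move: T;
  apply: (subgroup_gen_ind (P := fun T => (phi p T)`_i = 0)).
- by rewrite -(subrr (0 : D)) phi_additive subrr coef0.
- by move=> S T e e'; rewrite phi_additive coefB e e' subrr.
- by move=> _ [s [_ ss] <-]; apply: (phi_word gp); rewrite ss.
Qed.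

Lemma word_ind (P : D -> Prop) : P 0 -> (forall S T, P S -> P T -> P (S - T)) ->
  (forall s, P (word R s)) -> forall T, P T.
Proof.
move=> P0 PB Pw T; apply: (subgroup_gen_ind P0 PB _ (reduced_spanT T)).
by move=> _ [s [_ [->|->]]]; rewrite -?word_cons.
Qed.

Lemma phi_size n i (p : PG) T : graded_part n p -> (n < i)%N ->
  (phi p T)`_i = 0.
Proof.
move=> gp ni; move: T; apply: word_ind.
- by rewrite -(subrr (0 : D)) phi_additive subrr coef0.
- by move=> S T e e'; rewrite phi_additive coefB e e' subrr.
- by move=> s; apply: (phi_word gp); lia.
Qed.

Lemma coef_comp_polyNX (q : {poly int}) i : (q \Po - 'X)`_i = (-1) ^+ i * q`_i.
Proof.
elim/poly_ind: q i => [|q c IH] i; first by rewrite comp_poly0 coef0 mulr0.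
rewrite comp_poly_MXaddC mulrN !coefD coefN !coefMX !coefC.
by case: i => [|i] /=; rewrite ?oppr0 ?mul1r // !addr0 IH exprS mulN1r mulNr.
Qed.

Lemma series_mul_const S (T : D) m : series_mul S (const_series T) m = S m * T.
Proof.
rewrite /series_mul big_ord_recr /= subnn big1 ?add0r // => i _.
by have := ltn_ord i; rewrite -subn_gt0; case: (m - i)%N => // k _;
  rewrite mulr0.
Qed.

Lemma dual_eval_neg psi (T : D) m :
  dual_eval (dual_neg psi) (series_mul (Phi R) (const_series T)) m =
  \sum_(i < m.+1) (-1) ^+ i * (psi (dD R (m - i) * T))`_i.
Proof.
by apply: eq_bigr => i _;
  rewrite /dual_coef /dual_neg coef_comp_polyNX series_mul_const.
Qed.

Lemma dual_eval_const psi (T : D) m : zmod_morphism psi ->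
  dual_eval psi (const_series T) m = (psi T)`_m.
Proof.
move=> psiB; rewrite /dual_eval big_ord_recr /= subnn big1 ?add0r // => i _.
have := ltn_ord i; rewrite -subn_gt0; case: (m - i)%N => // k _ /=.
by rewrite /dual_coef -(subrr (0 : D)) psiB subrr coef0.
Qed.

(** The reversal makes the head of [s] the factor that acts first. An element [p1] from [c_operator]
    settles the empty word and the heads at least 3; [p2] from [d_operator] corrects head 2 and, by
    [xi p2 = 0] and the vanishing of its higher face operators, disturbs nothing else. *)
Lemma realize_word_values n (g : seq nat ->
  int) : exists p : PG, graded_part n p /\
  forall s, all (leq 2) s -> (sumn s <= n)%N ->
    (phi p (word R (rev s)))`_(n - sumn s) = g s.
Proof.
elim/ltn_ind: n g => -[_ g|m IH g].
  exists (pt R *~ g [::]); split.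
    apply: graded_Mz; have := graded_cls (point_polytope (0 : 'rV[R]_0)).
    by rewrite dim_point.
  case=> [_ _|a s /= /andP[a2 _]]; last by lia.
  rewrite /phi -/(ev _ _) /word /rev big_nil ev1 raddfMz /=.
  rewrite /pt xi_cls ?dim_point; last exact: point_polytope.
  by rewrite -scaler_int coefZ coefXn mulr1 intz.
(* As d_(a+1) on [p1] is d_a on [Q], the values prescribed for [Q] are those of [g] with the head
   raised by one. *)
have [Q [gQ HQ]] := IH m (ltnSn m) (fun s =>
  if s is a :: s' then g (a.+1 :: s') else g [::]).
have [p1 [gp1 xp1 fp1]] := c_operator gQ.
have [g0 gB gD] := graded_closed R m.+1.
(* On head 2, [p1] gives d_1 [Q], over which the induction hypothesis has no control; [h] is the
   resulting error. *)
pose h s := g (2%N :: s) - (phi p1 (word R (rev (2%N :: s))))`_(m.-1 - sumn s).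
have [p2 [gp2 xp2 fp2 hp2]] : exists p2 : PG, [/\ graded_part m.+1 p2,
  xi p2 = 0,
    forall k, face_op R k.+3 p2 = 0 & forall s, all (leq 2) s ->
      (2 + sumn s <= m.+1)%N ->
      (phi (face_op R 2 p2) (word R (rev s)))`_(m.-1 - sumn s) = h s].
  (* For m = 0 no word with head 2 has degree at most 1, and 0 will do. *)
  case: m {gQ HQ Q xp1 fp1 gB gD} IH g0 gp1 h => [|m] IH g0 gp1 h.
    by exists 0; split=> //; rewrite ?raddf0 // => k; rewrite raddf0.
  have [S [gS HS]] := IH m (ltnW (ltnSn m.+1)) h.
  have [p2 [gp2 xp2 f2 f3]] := d_operator gS.
  by exists p2; split=> // s hs ss; rewrite f2 HS.
exists (p1 + p2); split; first exact: gD.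
have ev_word (p : PG) a s : phi p (word R (rev (a :: s))) =
  phi (face_op R a p) (word R (rev s)).
  by rewrite rev_cons word_rcons.
have phiD (p q : PG) T : phi (p + q) T = phi p T + phi q T.
  have phiN : phi (- q) T = - phi q T.
    by rewrite -[- q]sub0r phiB -[X in phi X]/(0 : PG) -{1}(subrr (0 : PG))
      phiB subrr sub0r.
  by rewrite -[q in LHS]opprK phiB phiN opprK.
case=> [_ _|[//|[//|[|a]]] s /= hs ss].
- by have := HQ [::] isT (leq0n _);
    rewrite /phi -!/(ev _ _) /rev /word /= !big_nil !ev1 !subn0 xiD xp1 xp2
      addr0 coefXM.
- rewrite phiD coefD [in X in _ + X]ev_word (_ : (m.+1 - (2 + sumn s))%N =
    (m.-1 - sumn s)%N); last by lia.
  by rewrite hp2 // /h addrC subrK.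
- rewrite phiD coefD !ev_word fp1 fp2.
  have -> : phi (0 : PG) (word R (rev s)) =
    0 by rewrite -(subrr (0 : PG)) phiB subrr.
  rewrite coef0 addr0 -ev_word subSS.
  by rewrite (HQ (a.+2 :: s)) //; lia.
Qed.

End Image.

(** * Necessity and uniqueness *)

Section Characterization.
Variable R : realType.
Local Notation PG := (polytope_group R).
Local Notation D := (Dring R).

Lemma dual_poly_additive (psi : D -> {poly int}) : dual_poly psi ->
  zmod_morphism psi.
Proof.
move=> [N [psi_ [gd psiE]]] S T; rewrite !psiE; apply/polyP => i.
rewrite coefB !coef_poly; case: ifP => _; last by rewrite subr0.
by have [add _] := gd i; apply: add.
Qed.

Lemma homogeneous_coef n (psi : D -> {poly int}) k i (T : D) :
  homogeneous n psi -> Dgraded k T -> (i + k)%N <> n -> (psi T)`_i = 0.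
Proof.
move=> [h1 h2] kT ne; have [ni|ni] := ltnP n i.
  exact: (congr1 (fun f => f T) (h2 i ni)).
have [_ van] := h1 i (n - i)%N (subnKC ni).
by apply: (van k T _ kT); lia.
Qed.

Lemma word_Dgraded s : all (leq 1) s -> @Dgraded R (sumn s) (word R s).
Proof.
move=> hs; have [Ugen _ _ _] := subgroup_gen_closed
  [set \prod_(i <- s') dD R i | s' in [set s' : seq nat | all (leq 1) s' /\
    sumn s' = sumn s]].
by apply: Ugen; exists s.
Qed.

Lemma phi_homogeneous n (p : PG) : graded_part n p ->
  dual_poly (phi p) /\ homogeneous n (phi p).
Proof.
move=> gp; have add i : zmod_morphism (dual_coef (phi p) i).
  by move=> S T; rewrite /dual_coef phi_additive coefB.
split.
  exists n.+1, (dual_coef (phi p)); split=> [i|T].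
    split=> //; exists n.+1 => k T nk kT; apply: (phi_graded gp kT); lia.
  apply/polyP => i; rewrite coef_poly; case: ltnP => // ni.
  by rewrite (phi_size T gp).
split=> [i j ij|i ni]; last by apply/funext => T; apply: (phi_size T gp).
by split=> // k T kj kT; apply: (phi_graded gp kT); lia.
Qed.

Lemma phi_functional_equation (p : PG) (T : D) :
  dual_eval (dual_neg (phi p)) (series_mul (Phi R) (const_series T)) =
  dual_eval (phi p) (const_series T).
Proof.
apply/funext => m; rewrite dual_eval_neg dual_eval_const;
  last exact: phi_additive.
exact: xi_euler.
Qed.

Lemma eq0_on_reduced_words n (psi : D -> {poly int}) : zmod_morphism psi ->
  (forall k i T, Dgraded k T -> (i + k)%N <> n -> (psi T)`_i = 0) ->
  (forall T m, \sum_(i < m.+1) (-1) ^+ i * (psi (dD R (m - i) * T))`_i =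
    (psi T)`_m) ->
  (forall s, all (leq 2) s -> (sumn s <= n)%N ->
    (psi (word R s))`_(n - sumn s) = 0) ->
  forall T, psi T = 0.
Proof.
move=> psiB psi_hom psi_eq psi_red.
have red s : all (leq 2) s -> psi (word R s) = 0.
  move=> hs; apply/polyP => i; rewrite coef0.
  have [e|ne] := eqVneq (i + sumn s)%N n.
    by rewrite -[RHS](psi_red s hs) -?e ?leq_addl // addnK.
  apply: (psi_hom (sumn s)); last exact/eqP.
  apply: word_Dgraded.
  by apply: sub_all hs => a; apply: ltnW.
have red1 s : all (leq 2) s -> psi (word R (1%N :: s)) = 0.
  move=> hs; apply/polyP => i; rewrite coef0.
  have [e|ne] := eqVneq (i + (sumn s).+1)%N n; last first.
    apply: (psi_hom (sumn (1%N :: s))); last by rewrite /= add1n; apply/eqP.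
    by apply: word_Dgraded; rewrite /=; apply: sub_all hs => a; apply: ltnW.
  (* In coefficient [i.+1] of the equation at w, the term of index i is d_1 w, that of index [i.+1]
     is w itself, and the lower ones are d_k w with k at least 2. All but the first are already
     known to vanish. *)
  have := psi_eq (word R s) i.+1; rewrite (red s hs) coef0.
  rewrite (bigD1 (Ordinal (ltnW (ltnSn i.+1)))) //= subSnn -word_cons big1
    ?addr0.
    by move/eqP; rewrite mulf_eq0 signr_eq0 => /eqP.
  move=> j; rewrite -val_eqE /= => ji.
  have [ej|nj] := eqVneq (j : nat) i.+1.
    by rewrite ej subnn dD0 mul1r red // coef0 mulr0.
  rewrite -word_cons red ?coef0 ?mulr0 //= hs andbT.
  by move/eqP: ji; move/eqP: nj; have := ltn_ord j; lia.
move=> T; apply: (subgroup_gen_ind (P := fun T => psi T =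
  0) _ _ _ (reduced_spanT T)).
- by rewrite -(subrr (0 : D)) psiB subrr.
- by move=> U V eU eV; rewrite psiB eU eV subrr.
- by move=> _ [s [hs [->|->]]]; rewrite -?word_cons; [apply: red | apply: red1].
Qed.

End Characterization.

Theorem proposition25 (R : realType) (n : nat) :
  @phi R @` @graded_part R n =
  [set psi : Dring R -> {poly int} |
     [/\ dual_poly psi, homogeneous n psi &
         forall D : Dring R,
           dual_eval (dual_neg psi) (series_mul (Phi R) (const_series D)) =
           dual_eval psi (const_series D)]].
Proof.
apply/seteqP; split=> [_ [p gp <-]|psi [psi_poly psi_hom psi_eq]].
  by have [h1 h2] := phi_homogeneous gp; split=> // T; apply: phi_functional_equation.
have psiB := dual_poly_additive psi_poly.
(* This matches psi on the words with letters at least 2 only; uniqueness, applied to the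
   difference, extends the agreement to all of D. *)
have [p [gp Hp]] := @realize_word_values R n (fun s => (psi (word R (rev s)))`_(n - sumn s)).
exists p => //; apply/funext => T; apply/eqP; rewrite -subr_eq0; apply/eqP.
have [_ phi_hom] := phi_homogeneous gp.
apply: (eq0_on_reduced_words (n := n) (psi := fun T => phi p T - psi T)) T.
- by move=> S T; rewrite phi_additive psiB; ring.
- move=> k i T kT ne.
  by rewrite coefB (homogeneous_coef phi_hom kT ne) (homogeneous_coef psi_hom kT ne) subrr.
- move=> T m; have := congr1 (fun f => f m) (psi_eq T).
  have := congr1 (fun f => f m) (phi_functional_equation p T).
  rewrite !dual_eval_neg !dual_eval_const //; last exact: phi_additive.
  move=> e1 e2; rewrite coefB -e1 -e2 -sumrB; apply: eq_bigr => i _.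
  by rewrite coefB mulrBr.
- move=> s hs ss; have := Hp (rev s).
  by rewrite all_rev sumn_rev revK coefB => -> //; rewrite subrr.
Qed.
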